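(* Suppose that the quadratic module $\mathcal{Q}(G)$ is Archimedean and that the Slater condition holds for the problem $(P)$. Then $p^{\mathrm{sos}}_k$ decreasingly converges to $p^*$ as $k\to\infty$ (that is, the sequence $(p^{\mathrm{sos}}_k)_{k\ge d_P}$ is non-increasing and has limit $p^*$).
   Context: Notation: $\mathbb{R}[Y]=\mathbb{R}[Y_1,\dots,Y_n]$, and $\Sigma^2[Y]$ is the set of polynomials in $\mathbb{R}[Y]$ that are finite sums of squares of polynomials. Let $c\in\mathbb{R}^m$, $a(Y)=(a_1(Y),\dots,a_m(Y))^T\in\mathbb{R}[Y]^m$, $b(Y)\in\mathbb{R}[Y]$, $G=\{g_1,\dots,g_s\}\subset\mathbb{R}[Y]$, and $S=\{y\in\mathbb{R}^n : g_1(y)\ge0,\dots,g_s(y)\ge0\}$. The linear semi-infinite polynomial programming problem is $$(P)\qquad p^*:=\inf_{x\in\mathbb{R}^m} c^Tx\quad\text{s.t.}\quad a(y)^Tx+b(y)\ge0\ \ \forall y\in S.$$ Standing assumptions: $(P)$ is feasible and bounded from below, i.e. $-\infty<p^*<\infty$, and $S$ is compact. Quadratic module: $\mathcal{Q}(G)=\{\sum_{j=0}^s\sigma_jg_j : g_0=1,\ \sigma_j\in\Sigma^2[Y]\}$; truncation: $\mathcal{Q}_k(G)=\{\sum_{j=0}^s\sigma_jg_j : g_0=1,\ \sigma_j\in\Sigma^2[Y],\ \deg(\sigma_jg_j)\le 2k\}$. $\mathcal{Q}(G)$ is Archimedean if there is $\psi\in\mathcal{Q}(G)$ such that $\{y\in\mathbb{R}^n:\psi(y)\ge0\}$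 is compact. The Slater condition holds for $(P)$ if there is $\bar x\in\mathbb{R}^m$ with $a(y)^T\bar x+b(y)>0$ for all $y\in S$. Let $d_j=\lceil\deg(g_j)/2\rceil$, $d_S=\max\{1,d_1,\dots,d_s\}$, $d_P=\max\{d_S,\lceil\deg(a_1)/2\rceil,\dots,\lceil\deg(a_m)/2\rceil,\lceil\deg(b)/2\rceil\}$. For integers $k\ge d_P$, $$p^{\mathrm{sos}}_k:=\inf_{x\in\mathbb{R}^m}c^Tx\quad\text{s.t.}\quad a(Y)^Tx+b(Y)\in\mathcal{Q}_k(G),$$ with the infimum over the empty set equal to $+\infty$. *)

(* Defs.v *)
From HB Require Import structures.
From mathcomp Require Import all_boot all_order all_algebra.
From mathcomp Require Import all_classical all_reals all_analysis.
From mathcomp Require mpoly.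
(* The notations of mpoly clash with those of the analysis library; only its
   structure instances are imported. *)
Import (canonicals, coercions) mpoly.

Set Implicit Arguments.
Unset Strict Implicit.
Unset Printing Implicit Defensive.

Import Order.TTheory GRing.Theory Num.Theory.
Import numFieldNormedType.Exports.

Local Open Scope classical_set_scope.
Local Open Scope ring_scope.

Definition peval (R : realType) (n : nat) (p : mpoly.mpoly n R)
  (y : 'rV[R]_n) : R := mpoly.meval (fun i => y ord0 i) p.

(* [msize p] is one plus the total degree, and 0 for p = 0; hence
   [pdeg 0 = 0], which makes no difference to the bounds below. *)
Definition pdeg (R : realType) (n : nat) (p : mpoly.mpoly n R) : nat :=
  (mpoly.msize p).-1.

Definition half_deg (R : realType) (n : nat) (p : mpoly.mpoly n R) : nat :=
  uphalf (pdeg p).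

Definition is_sos (R : realType) (n : nat) (p : mpoly.mpoly n R) : Prop :=
  exists qs : seq (mpoly.mpoly n R), p = \sum_(q <- qs) q ^+ 2.

Definition semialg_set (R : realType) (n s : nat)
  (g : 'I_s -> mpoly.mpoly n R) : set 'rV[R]_n :=
  [set y | forall j, 0 <= peval (g j) y].

(* The multiplier of the constant g_0 = 1 is kept apart as [s0]. *)
Definition quad_module (R : realType) (n s : nat)
  (g : 'I_s -> mpoly.mpoly n R) : set (mpoly.mpoly n R) :=
  [set p | exists (s0 : mpoly.mpoly n R) (sg : 'I_s -> mpoly.mpoly n R),
     [/\ is_sos s0, forall j, is_sos (sg j) &
         p = s0 + \sum_(j < s) sg j * g j]].

Definition quad_module_trunc (R : realType) (n s : nat)
  (g : 'I_s -> mpoly.mpoly n R) (k : nat) : set (mpoly.mpoly n R) :=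
  [set p | exists (s0 : mpoly.mpoly n R) (sg : 'I_s -> mpoly.mpoly n R),
     [/\ is_sos s0 /\ (forall j, is_sos (sg j)),
         (pdeg s0 <= 2 * k)%N,
         (forall j, (pdeg (sg j * g j)%R <= 2 * k)%N) &
         p = s0 + \sum_(j < s) sg j * g j]].

Definition archimedean_module (R : realType) (n s : nat)
  (g : 'I_s -> mpoly.mpoly n R) : Prop :=
  exists psi : mpoly.mpoly n R,
    quad_module g psi /\ compact [set y : 'rV[R]_n | 0 <= peval psi y].

Definition objective (R : realType) (m : nat) (c x : 'cV[R]_m) : R :=
  \sum_(i < m) c i ord0 * x i ord0.

Definition constraint_value (R : realType) (n m : nat)
  (a : 'I_m -> mpoly.mpoly n R) (b : mpoly.mpoly n R) (x : 'cV[R]_m)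
  (y : 'rV[R]_n) : R :=
  \sum_(i < m) peval (a i) y * x i ord0 + peval b y.

Definition constraint_poly (R : realType) (n m : nat)
  (a : 'I_m -> mpoly.mpoly n R) (b : mpoly.mpoly n R) (x : 'cV[R]_m) :
  mpoly.mpoly n R :=
  \sum_(i < m) x i ord0 *: a i + b.

Definition slater (R : realType) (n m s : nat)
  (a : 'I_m -> mpoly.mpoly n R) (b : mpoly.mpoly n R)
  (g : 'I_s -> mpoly.mpoly n R) : Prop :=
  exists x : 'cV[R]_m,
    forall y, semialg_set g y -> 0 < constraint_value a b x y.

Definition p_star (R : realType) (n m s : nat) (c : 'cV[R]_m)
  (a : 'I_m -> mpoly.mpoly n R) (b : mpoly.mpoly n R)
  (g : 'I_s -> mpoly.mpoly n R) : \bar R :=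
  ereal_inf [set (objective c x)%:E | x in
    [set x : 'cV[R]_m |
       forall y, semialg_set g y -> 0 <= constraint_value a b x y]].

Definition p_sos (R : realType) (n m s : nat) (c : 'cV[R]_m)
  (a : 'I_m -> mpoly.mpoly n R) (b : mpoly.mpoly n R)
  (g : 'I_s -> mpoly.mpoly n R) (k : nat) : \bar R :=
  ereal_inf [set (objective c x)%:E | x in
    [set x : 'cV[R]_m | quad_module_trunc g k (constraint_poly a b x)]].

Definition d_S (R : realType) (n s : nat) (g : 'I_s -> mpoly.mpoly n R) : nat :=
  maxn 1 (\max_(j < s) half_deg (g j)).

Definition d_P (R : realType) (n m s : nat)
  (a : 'I_m -> mpoly.mpoly n R) (b : mpoly.mpoly n R)
  (g : 'I_s -> mpoly.mpoly n R) : nat :=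
  maxn (d_S g) (maxn (\max_(i < m) half_deg (a i)) (half_deg b)).

(* Main.v *)
(* The core is Putinar's Positivstellensatz: if Q(G) is Archimedean and f > 0 on
   S, then f is in Q(G). Moving a feasible x slightly towards a Slater point
   makes a(y)^T x + b(y) positive on S, hence a member of some Q_k(G), which gives
   inf_k p_k^sos <= p^*; the other inequality and the monotonicity are clear.

   The Archimedean hypothesis only provides psi in Q(G) with {psi >= 0} compact,
   and psi may be negative but tend to 0 at infinity; that some N - |x|^2 is
   nevertheless in Q(G) requires the Krivine-Stengle Positivstellensatz, followed
   by Woermann's trick. It is proved as follows. If -1 is not in a preordering P
   of R[x], restrict the coefficients to a countable subfield k of R, so that
   k[x] maps to a countable field, hence to an algebraically closed field, with P
   proper in it; a maximal subfield in which P generates no -1 is a real closed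
   field where the members of P are nonnegative, and quantifier elimination over k
   brings a point back to R.

   Putinar's theorem then follows Jacobi: in an Archimedean algebra a maximal
   quadratic module M defines a character a |-> sup {r | a - r in M}. *)

Require Import Defs.
From HB Require Import structures.
From mathcomp Require Import all_boot all_order all_algebra.
From mathcomp Require Import all_classical all_reals all_analysis.
From mathcomp Require Import zify ring.
From mathcomp Require mpoly.
From mathcomp Require closed_field qe_rcf_th qe_rcf.
Import (canonicals, coercions) mpoly.

Set Implicit Arguments.
Unset Strict Implicit.
Unset Printing Implicit Defensive.

Import Order.TTheory GRing.Theory Num.Theory.
Import numFieldNormedType.Exports.

Local Open Scope classical_set_scope.
Local Open Scope ring_scope.

(** * Real closed fields from proper preorderings *)

(** A quadratic module is closed only under multiplication by squares, whereas the Krivine-Stengle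
    certificate and Woermann's trick both multiply members. A single weight reconciles them:
    [sos + sos psi] is a preordering, because [psi ^+ 2] is a square, and it lies in Q(G). Passing
    to the countable [k] shapes the rest. Members of the preordering, positive constants of [k]
    included, need not be squares, so the subfield is taken maximal for sums of squares weighted by
    their images; maximality then turns every weight into a square. The order of [k] is kept because
    its positive constants are squares over R, hence in the preordering. Finally, the real closed
    field so obtained shares with R only the subfield [k], so elimination must be uniform: a formula
    over [k] is eliminated once and the result is read in both fields. *)

Lemma zorn_set (U : Type) (P : set U -> Prop) (S0 : set U) :
    P S0 ->
    (forall F : set (set U), F !=set0 -> F `<=` P -> total_on F subset ->
       P (\bigcup_(X in F) X)) ->
  exists M, [/\ P M, S0 `<=` M & forall N, P N -> M `<=` N -> N = M].
Proof.
move=> PS0 Pchain.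
(* [Zorn_bigcup] also asks for the union of the empty chain; the disjunct [X = set0] admits it and
   is discarded once [M] is maximal. *)
have [|M [PM maxM]] := @Zorn_bigcup U (fun X => X = set0 \/ P X /\ S0 `<=` X).
  move=> F FP Ftot.
  have [[X [FX X0]]|noX] := pselect (exists X, F X /\ X <> set0); last first.
    left; rewrite -subset0 => x [X FX Xx]; apply: noX; exists X; split=> //.
    by move=> X0; rewrite X0 in Xx.
  have [//|[PX S0X]] := FP X FX.
  right; split; last by apply: subset_trans S0X _; apply: bigcup_sup.
  have -> : \bigcup_(Y in F) Y = \bigcup_(Y in F `&` [set Y | Y <> set0]) Y.
    apply/seteqP; split=> x [Y FY Yx]; last by exists Y => //; case: FY.
    by exists Y => //; split=> // Y0; rewrite Y0 in Yx.
  apply: Pchain; first by exists X.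
    by move=> Y [FY Y0]; have [//|[]] := FP Y FY.
  by move=> Y Z [FY _] [FZ _]; apply: Ftot.
have {PM} [PM S0M] : P M /\ S0 `<=` M.
  case: PM => // M0; rewrite M0 in maxM *.
  have [S00|S0n] := pselect (S0 = set0); first by rewrite -S00; split.
  exfalso; apply: (maxM S0); last by right; split.
  by split=> // S0sub; apply: S0n; rewrite -subset0.
exists M; split=> // N PN MN; apply: contrapT => NM.
apply: (maxM N); last by right; split=> //; exact: subset_trans MN.
by split=> // NsubM; apply: NM; apply/seteqP.
Qed.

Definition preordering (A : comNzRingType) (T : set A) : Prop :=
  [/\ forall x y, T x -> T y -> T (x + y),
      forall x y, T x -> T y -> T (x * y) &
      forall x, T (x ^+ 2)].

Section Preordering.
Variables (A : comNzRingType) (T : set A).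
Hypothesis T_preo : preordering T.

Lemma preordering0 : T 0. Proof. by case: T_preo => _ _ /(_ 0); rewrite expr0n. Qed.
Lemma preordering1 : T 1. Proof. by case: T_preo => _ _ /(_ 1); rewrite expr1n. Qed.
Lemma preorderingD x y : T x -> T y -> T (x + y).
Proof. by case: T_preo => + _ _; apply. Qed.
Lemma preorderingM x y : T x -> T y -> T (x * y).
Proof. by case: T_preo => _ + _; apply. Qed.
Lemma preordering_sqr x : T (x ^+ 2). Proof. by case: T_preo. Qed.

Definition is_ideal (I : set A) : Prop :=
  [/\ I 0, forall x y, I x -> I y -> I (x + y) & forall a x, I x -> I (a * x)].

(** [I] is maximal among the ideals with -1 outside [T + I], so every [a] outside [I] yields
    [-1 = t + i + c * a]. The last property makes the quotient real relative to [T]; it is what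
    later allows denominators. *)
Lemma preordering_prime_ideal : ~ T (-1) ->
  exists I : set A, [/\ is_ideal I, ~ I 1,
    forall x y, I (x * y) -> I x \/ I y &
    forall s t, T t -> I (s ^+ 2 + t) -> I s].
Proof.
move=> Tn1.
pose P (I : set A) := is_ideal I /\ forall t i, T t -> I i -> t + i <> -1.
have [||I [[[I0 ID IM] Ip] _ Imax]] := @zorn_set A P [set 0].
- split; last by move=> t i Tt -> eq1; apply: Tn1; rewrite -eq1 addr0.
  by split=> [//|x y -> ->|a x ->]; rewrite ?addr0 ?mulr0.
- move=> F [X FX] FP Ftot; split; [split|].
  + by exists X => //; case: (FP X FX) => [[]].
  + move=> x y [Y FY Yx] [Z FZ Zy].
    have [YZ|ZY] := Ftot Y Z FY FZ.
      by exists Z => //; case: (FP Z FZ) => -[_ + _] _; apply=> //; apply: YZ.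
    by exists Y => //; case: (FP Y FY) => -[_ + _] _; apply=> //; apply: ZY.
  + by move=> a x [Y FY Yx]; exists Y => //; case: (FP Y FY) => -[_ _ +] _; apply.
  + by move=> t i Tt [Y FY Yi]; case: (FP Y FY) => _; apply.
have Iext a : ~ I a -> exists t i c, [/\ T t, I i & t + i + c * a = -1].
  move=> Ia; pose J := [set x | exists i c, I i /\ x = i + c * a].
  apply: contrapT => noJ.
  have JI : J = I.
    apply: Imax => [|x Ix]; last by exists x, 0; rewrite mul0r addr0.
    split; first split.
    - by exists 0, 0; rewrite mul0r addr0.
    - move=> x y [i [c [Ii ->]]] [j [d [Ij ->]]]; exists (i + j), (c + d).
      by split; [exact: ID|ring].
    - move=> b x [i [c [Ii ->]]]; exists (b * i), (b * c).
      by split; [exact: IM|ring].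
    - move=> t x Tt [i [c [Ii ->]]] eq1; apply: noJ; exists t, i, c.
      by rewrite -addrA.
  by apply: Ia; rewrite -JI; exists 0, 1; rewrite add0r mul1r.
have IN x : I x -> I (- x) by rewrite -mulN1r; exact: IM.
have IB x y : I x -> I y -> I (x - y) by move=> Ix Iy; apply: ID => //; exact: IN.
exists I; split=> //.
- move=> I1; apply: (Ip 0 (-1)); [exact: preordering0|exact: IN|].
  by rewrite add0r.
- move=> x y Ixy; apply: contrapT => /not_orP[Ix Iy].
  have [t [i [c [Tt Ii ex]]]] := Iext x Ix.
  have [u [j [d [Tu Ij ey]]]] := Iext y Iy.
  (* The product of [c x = -(1 + t + i)] and [d y = -(1 + u + j)] expresses -1 as [t + u + t u] plus
     an element of [I]. *)
  apply: (Ip (t + u + t * u) ((1 + t) * j + i * (1 + u + j) - c * d * (x * y))).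
  + apply: preorderingD; last exact: preorderingM.
    exact: preorderingD.
  + by apply: IB; [apply: ID; [|rewrite mulrC]|]; apply: IM.
  + have -> : c * d * (x * y) = (c * x) * (d * y) by ring.
    have -> : c * x = -1 - t - i by rewrite -ex; ring.
    have -> : d * y = -1 - u - j by rewrite -ey; ring.
    by ring.
- move=> s t Tt Ist; apply: contrapT => Is.
  have [u [i [c [Tu Ii es]]]] := Iext s Is.
  (* Squaring [c s = -(1 + u + i)] and replacing [c^2 s^2] by [- c^2 t] modulo [I] puts -1 in
     [T + I]. *)
  apply: (Ip (u + u + u ^+ 2 + c ^+ 2 * t)
    (i * (2 + 2 * u + i) - c ^+ 2 * (s ^+ 2 + t))).
  + apply: preorderingD; last by apply: preorderingM => //; exact: preordering_sqr.
    by apply: preorderingD; [exact: preorderingD|exact: preordering_sqr].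
  + by apply: IB; [rewrite mulrC|]; apply: IM.
  + have -> : c ^+ 2 * (s ^+ 2 + t) = (c * s) ^+ 2 + c ^+ 2 * t by ring.
    have -> : c * s = -1 - u - i by rewrite -es; ring.
    by ring.
Qed.

End Preordering.

(** An injection into [nat] carries countability through the successive constructions; its partial
    inverse [g] makes [K] a [countFieldType]. *)
Lemma field_closed_hom (K : fieldType) (f : K -> nat) : injective f ->
  exists (C : closedFieldType), inhabited {rmorphism K -> C}.
Proof.
move=> f_inj.
pose g n : option K := if pselect (exists x, f x = n) is left ex
  then Some (projT1 (cid ex)) else None.
have fgK : pcancel f g.
  move=> x; rewrite /g; case: pselect => [ex|[]]; last by exists x.
  by congr Some; apply: f_inj; case: cid.
pose Kc : countFieldType := HB.pack (GRing.Field.sort K) (PCanIsCountable fgK).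
have [C [h _]] := closed_field.countable_algebraic_closure Kc.
by exists C; split; exact: h.
Qed.

(** Meant for the quotient by a prime ideal, which is integral but comes without an inverse
    operation; [i] chooses inverses classically. The map [v] goes back to [A] so that an encoding of
    [A] also encodes [D]. *)
Lemma comring_domain_pack (A : comNzRingType) :
    (forall x y : A, x * y = 0 -> (x == 0) || (y == 0)) ->
  exists (D : idomainType) (h : {rmorphism A -> D}) (v : D -> A),
    injective v /\ injective h.
Proof.
move=> integral.
pose u : {pred A} := fun x => `[< exists y, y * x = 1 >].
pose i (x : A) : A := if pselect (exists y, y * x = 1) is left ex
  then projT1 (cid ex) else x.
have mulVx : {in u, left_inverse 1 i *%R}.
  move=> x /asboolP ux; rewrite /i; case: pselect => // ex.
  by case: cid.
have unitPl x y : y * x = 1 -> u x by move=> yx1; apply/asboolP; exists y.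
have inv_out : {in [predC u], i =1 id}.
  by move=> x /asboolP ux; rewrite /i; case: pselect.
pose U : comUnitRingType := HB.pack (GRing.ComNzRing.sort A)
  (GRing.ComNzRing_hasMulInverse.Build A mulVx unitPl inv_out).
pose D : idomainType := HB.pack (GRing.ComUnitRing.sort U)
  (GRing.ComUnitRing_isIntegral.Build U integral).
by exists D, (idfun : {rmorphism A -> A}), id; split=> x y.
Qed.

Lemma domain_closed_hom (D : idomainType) (f : D -> nat) : injective f ->
  exists (C : closedFieldType) (h : {rmorphism D -> C}), forall x, h x = 0 -> x = 0.
Proof.
move=> f_inj.
pose g (x : {fraction D}) : nat :=
  let r := frac (generic_quotient.repr x) in choice.pickle (f r.1, f r.2).
have g_inj : injective g.
  move=> x y /(pcan_inj choice.pickleK)[/f_inj n_eq /f_inj d_eq].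
  apply: (can_inj generic_quotient.reprK); apply: val_inj => /=.
  by move: n_eq d_eq; case: (frac _) => ? ?; case: (frac _) => ? ? /= -> ->.
have [C [h]] := field_closed_hom g_inj.
exists C, (h \o @FracField.tofrac D) => x /= /eqP.
by rewrite fmorph_eq0 tofrac_eq0 => /eqP.
Qed.

Lemma prime_ideal_closed_hom (A : comNzRingType) (f : A -> nat) (I : set A) :
    injective f -> is_ideal I -> ~ I 1 ->
    (forall x y, I (x * y) -> I x \/ I y) ->
  exists (C : closedFieldType) (h : {rmorphism A -> C}), forall x, h x = 0 <-> I x.
Proof.
move=> f_inj [I0 ID IM] I1 Iprime.
pose Ib : {pred A} := fun x => `[< I x >].
have Ib_ideal : idealr_closed Ib.
  split; [exact/asboolP|exact/asboolP|move=> a x y /asboolP Ix /asboolP Iy].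
  by apply/asboolP/ID => //; exact: IM.
have Ib_prime : prime_idealr_closed Ib.
  move=> x y /asboolP/Iprime[Ix|Iy]; apply/orP; [left|right]; exact/asboolP.
pose Ip : prime_idealr A := HB.pack Ib (isIdealr.Build A Ib Ib_ideal)
  (isPrimeIdealrClosed.Build A Ib Ib_prime).
have [D [q [v [v_inj q_inj]]]] :=
  @comring_domain_pack (Quotient.quot Ip) (@Quotient.rquot_IdomainAxiom A Ip).
have fv_inj : injective (f \o (@generic_quotient.repr A (Quotient.quot Ip)) \o v).
  apply: inj_comp v_inj; apply: inj_comp f_inj _.
  exact: can_inj generic_quotient.reprK.
have [C [h h0]] := domain_closed_hom fv_inj.
pose p : {rmorphism A -> Quotient.quot Ip} :=
  (@generic_quotient.pi A (Quotient.quot Ip) : A -> Quotient.quot Ip).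
have p0 x : (p x = 0) <-> I x.
  have /= := @Quotient.idealrBE A Ip x 0.
  rewrite subr0 -(rmorph0 p) => Ipx; split=> [px0|Ix].
    by suff /asboolP : x \in Ip by []; rewrite Ipx; apply/eqP.
  by apply/eqP; rewrite -Ipx; apply/asboolP.
exists C, (h \o q \o p) => x /=; rewrite -p0; split=> [/h0|->].
  by rewrite -(rmorph0 q) => /q_inj.
by rewrite !rmorph0.
Qed.

(* In the irreducible case [1 + \sum q ^+ 2 = p * w], so [w] changes sign where
   [p] does and is shorter than [p]: a root of [w] would annihilate the left-hand
   side. *)
Lemma ivt_of_irreducible (F : realFieldType) :
    (forall p : {poly F}, irreducible_poly p -> (forall x, ~~ root p x) ->
       exists2 qs : seq {poly F}, (forall q, q \in qs -> (size q < size p)%N) &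
         p %| 1 + \sum_(q <- qs) q ^+ 2) ->
  Num.real_closed_axiom F.
Proof.
move=> irrP.
suff ivt n (p : {poly F}) a b : (size p <= n)%N -> a <= b -> p.[a] < 0 < p.[b] ->
    exists2 x, a <= x <= b & root p x.
  move=> p a b le_ab /andP[]; rewrite le_eqVlt => /predU1P[pa _|pa].
    by exists a; rewrite ?lexx ?rootE ?pa.
  rewrite le_eqVlt => /predU1P[pb|pb].
    by exists b; rewrite ?lexx ?le_ab ?rootE -?pb.
  by apply: (ivt (size p)) => //; apply/andP.
elim: n => [|n IHn] in p a b *.
  by rewrite leqn0 size_poly_eq0 => /eqP -> _; rewrite horner0 ltxx.
move=> le_pn le_ab /andP[pa pb].
have p0 : p != 0 by apply: contraTneq pa => ->; rewrite horner0 ltxx.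
(* If a product changes sign between [a] and [b], so does one of its factors; a factor going from
   positive to negative is negated before the induction hypothesis applies. *)
have split_root (q r : {poly F}) : p = q * r -> (size q <= n)%N -> (size r <= n)%N ->
    exists2 x, a <= x <= b & root p x.
  have sign (u : {poly F}) : (size u <= n)%N -> u.[a] * u.[b] < 0 ->
      exists2 x, a <= x <= b & root u x.
    move=> le_un; have [ua|ua|->] := ltgtP u.[a] 0; last by rewrite mul0r ltxx.
      by rewrite nmulr_rlt0 // => ub; apply: IHn; rewrite ?ua.
    rewrite pmulr_rlt0 // => ub; have [|//||x xab ux] := IHn (- u) a b.
    - by rewrite size_polyN.
    - by rewrite !hornerN oppr_lt0 oppr_gt0 ua.
    by exists x => //; rewrite -rootN.
  move=> pE le_qn le_rn; have : p.[a] * p.[b] < 0 by rewrite nmulr_rlt0.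
  have -> : p.[a] * p.[b] = (q.[a] * q.[b]) * (r.[a] * r.[b]).
    by rewrite pE !hornerM; ring.
  have [qab|qab|->] := ltgtP (q.[a] * q.[b]) 0; last by rewrite mul0r ltxx.
    by move=> _; have [x xab qx] := sign q le_qn qab; exists x; rewrite // pE rootM qx.
  rewrite pmulr_rlt0 // => /(sign r le_rn)[x xab rx].
  by exists x; rewrite // pE rootM rx orbT.
have sz_p : (1 < size p)%N.
  rewrite ltnNge; apply: contraTN pb => /size1_polyC pc; move: pa.
  by rewrite pc !hornerC => /ltW; rewrite leNgt.
have [p_irr|p_red] := pselect (irreducible_poly p); last first.
  have [q [q1 qp nqp]] : exists q : {poly F}, [/\ size q != 1%N, q %| p & ~~ (q %= p)].
    apply: contrapT => noq; apply: p_red; split=> // q q1 qp.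
    by apply: contrapT => /negP nqp; apply: noq; exists q.
  move: (qp) => /dvdpP[r pE].
  have q0 : q != 0 by apply: contraNneq p0 => q0; rewrite pE q0 mulr0.
  have r0 : r != 0 by apply: contraNneq p0 => r0; rewrite pE r0 mul0r.
  have sz_qp : (size q < size p)%N.
    rewrite ltn_neqAle dvdp_leq // andbT; apply: contraNneq nqp => szE.
    by rewrite -(dvdp_size_eqp qp) szE.
  have sz_rp : (size r < size p)%N.
    have szq : (1 < size q)%N by rewrite ltn_neqAle eq_sym q1 size_poly_gt0.
    rewrite pE size_mul // -subn1 -addnBA ?size_poly_gt0 //.
    by rewrite -[X in (X < _)%N]addn0 ltn_add2l subn_gt0.
  by apply: (split_root r q) => //; rewrite -ltnS; exact: leq_trans le_pn.
have [[x px]|noroot] := pselect (exists x, root p x).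
  have p_lin : size p = 2.
    have [_ /(_ ('X - x%:P))] := p_irr; rewrite size_XsubC dvdp_XsubCl => /(_ isT px).
    by move/eqp_size => <-; rewrite size_XsubC.
  have pE : p = p`_1 *: ('X - x%:P).
    have /dvdpP[r pE] : 'X - x%:P %| p by rewrite dvdp_XsubCl.
    have r0 : r != 0 by apply: contraNneq p0 => r0; rewrite pE r0 mul0r.
    have : size r = 1%N.
      move: p_lin; rewrite pE size_mul ?polyXsubC_eq0 // size_XsubC addn2 /=.
      by case.
    move=> /eqP/size_poly1P[d d0 rd]; rewrite {1}pE rd mul_polyC; congr (_ *: _).
    by rewrite pE rd mul_polyC coefZ coefB coefX coefC subr0 mulr1.
  exists x => //; move: pa pb; rewrite pE !hornerE => pa pb.
  have [c0|c0|c0] := ltgtP p`_1 0.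
  - move: pa pb; rewrite nmulr_rlt0 // nmulr_rgt0 // subr_gt0 subr_lt0.
    by move=> xa bx; have := lt_trans bx xa; rewrite ltNge le_ab.
  - move: pa pb; rewrite pmulr_rlt0 // pmulr_rgt0 // subr_gt0 subr_lt0.
    by move=> /ltW -> /ltW ->.
  - by move: pa; rewrite c0 mul0r ltxx.
have [|qs szqs qsP] := irrP p p_irr.
  by move=> x; apply/negP => px; apply: noroot; exists x.
have [w wE] : exists w : {poly F}, 1 + \sum_(q <- qs) q ^+ 2 = w * p.
  exact/dvdpP.
have sum_gt0 x : 0 < (1 + \sum_(q <- qs) q ^+ 2).[x].
  rewrite hornerD hornerC horner_sum ltr_wpDr //.
  by apply: sumr_ge0 => q _; rewrite horner_exp sqr_ge0.
have w0 : w != 0.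
  by apply/eqP => w0; have := sum_gt0 0; rewrite wE w0 mul0r horner0 ltxx.
have sz_wp : (size w < size p)%N.
  have : (size (w * p)%R <= (size p + size p).-2.-1)%N.
    rewrite -wE; apply: leq_trans (size_polyD _ _) _.
    rewrite size_poly1 geq_max; apply/andP; split.
      by move: sz_p; lia.
    apply: leq_trans (size_sum _ _ _) _; apply/bigmax_leqP_seq => q qqs _.
    apply: leq_trans (size_poly_exp_leq _ _) _; move: (szqs q qqs) sz_p.
    by lia.
  have arith (i j : nat) :
    ((i + j).-1 <= (j + j).-2.-1 -> 1 < j -> 0 < i -> i < j)%N by lia.
  by rewrite size_mul // => /arith; apply; rewrite ?size_poly_gt0.
have wa : w.[a] < 0.
  by have := sum_gt0 a; rewrite wE hornerM nmulr_lgt0.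
have wb : 0 < w.[b].
  by have := sum_gt0 b; rewrite wE hornerM pmulr_lgt0.
have [|//||x _ wx] := IHn w a b; rewrite ?wa ?wb //.
  by rewrite -ltnS; apply: leq_trans le_pn.
by have := sum_gt0 x; rewrite wE hornerM (rootP wx) mul0r ltxx.
Qed.

(** The order is [x <= y] iff [y - x] is a square, the only candidate in a real closed field. The
    first hypothesis makes it total, the second antisymmetric; together they make squares closed
    under addition. *)
Lemma rcf_of_squares (L : fieldType) :
    (forall x : L, exists y, x = y ^+ 2 \/ x = - y ^+ 2) ->
    (forall qs : seq L, 1 + \sum_(q <- qs) q ^+ 2 != 0) ->
    (forall p : {poly L}, irreducible_poly p -> (forall x, ~~ root p x) ->
       exists2 qs : seq {poly L}, (forall q, q \in qs -> (size q < size p)%N) &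
         p %| 1 + \sum_(q <- qs) q ^+ 2) ->
  exists F : rcfType, inhabited {rmorphism L -> F}.
Proof.
move=> sq_total sq_real irrP.
pose le (x y : L) := `[< exists z, y - x = z ^+ 2 >].
pose lt x y := (y != x) && le x y.
pose norm x := if le 0 x then x else - x.
have sum_sq0 (x y : L) : x ^+ 2 + y ^+ 2 = 0 -> x = 0.
  move=> xy0; apply/eqP; apply/negP => /negP x0.
  have := sq_real [:: y / x]; rewrite big_seq1.
  have -> : 1 + (y / x) ^+ 2 = (x ^+ 2 + y ^+ 2) / x ^+ 2 by field.
  by rewrite xy0 mul0r eqxx.
have le0P x : reflect (exists z, x = z ^+ 2) (le 0 x).
  by rewrite /le subr0; apply: asboolP.
have le0_add x y : le 0 x -> le 0 y -> le 0 (x + y).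
  move=> /le0P[u ->] /le0P[v ->]; apply/le0P.
  have [w [->|wE]] := sq_total (u ^+ 2 + v ^+ 2); first by exists w.
  have u0 : u = 0.
    apply/eqP; apply/negP => /negP u0.
    have := sq_real [:: v / u; w / u]; rewrite big_cons big_seq1.
    have -> : 1 + ((v / u) ^+ 2 + (w / u) ^+ 2)
        = (u ^+ 2 + v ^+ 2 + w ^+ 2) / u ^+ 2 by field.
    by rewrite wE addNr mul0r eqxx.
  by exists v; rewrite u0 expr0n add0r.
have le0_mul x y : le 0 x -> le 0 y -> le 0 (x * y).
  by move=> /le0P[u ->] /le0P[v ->]; apply/le0P; exists (u * v); rewrite exprMn.
have le_opp x : le x 0 -> exists z, x = - z ^+ 2.
  by move=> /asboolP[z]; rewrite sub0r => zE; exists z; rewrite -zE opprK.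
have le0_anti x : le 0 x -> le x 0 -> x = 0.
  move=> /le0P[u ->] /le_opp[v]  /eqP; rewrite -addr_eq0 => /eqP /sum_sq0 ->.
  by rewrite expr0n.
have sub_ge0 x y : le 0 (y - x) = le x y by rewrite /le subr0.
have le0_total x : le 0 x || le x 0.
  have [z [xE|xE]] := sq_total x; apply/orP; [left|right].
    by apply/le0P; exists z.
  by apply/asboolP; exists z; rewrite xE sub0r opprK.
have normN x : norm (- x) = norm x.
  rewrite /norm; case: ifPn => Nx; case: ifPn => x0 //.
  - apply: esym; rewrite [X in _ = - X]le0_anti ?oppr0 //; last first.
      by rewrite -sub_ge0 sub0r.
    by apply: le0_anti => //; rewrite -sub_ge0 sub0r.
  - by rewrite opprK.
  - case/negP: Nx; move: (le0_total x); rewrite (negPf x0) /=.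
    by rewrite -sub_ge0 sub0r.
have ge0_norm x : le 0 x -> norm x = x by rewrite /norm => ->.
have lt_def x y : lt x y = (y != x) && le x y by [].
pose F0 : realFieldType := HB.pack (GRing.Field.sort L)
  (Num.IntegralDomain_isLeReal.Build L le0_add le0_mul le0_anti sub_ge0
     le0_total normN ge0_norm lt_def).
have F0_ivt : Num.real_closed_axiom F0 by exact: ivt_of_irreducible.
pose F : rcfType := HB.pack (Num.RealField.sort F0)
  (Num.RealField_isClosed.Build F0 F0_ivt).
by exists F; split; exact: (idfun : {rmorphism L -> L}).
Qed.

(** The set [K] is arbitrary, as it will be either a subfield, where a multiplicative [W] generates
    a preordering in this way, or the polynomials below a given size, which are not closed under
    products. *)
Inductive wsos (A : comNzRingType) (W K : set A) : set A :=
| wsos0 : wsos W K 0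
| wsosS x w u of wsos W K x & W w & K u : wsos W K (x + w * u ^+ 2).

Section WeightedSumsOfSquares.
Variables (A : comNzRingType) (W K : set A).
Hypotheses (W1 : W 1) (WM : forall x y, W x -> W y -> W (x * y)).
Hypotheses (K1 : K 1) (KM : forall x y, K x -> K y -> K (x * y)).

Lemma wsos_term w u : W w -> K u -> wsos W K (w * u ^+ 2).
Proof. by move=> Ww Ku; rewrite -[X in wsos W K X]add0r; do ?constructor. Qed.

Lemma wsos_weight w : W w -> wsos W K w.
Proof. by move=> Ww; rewrite -[w]mulr1 -(expr1n _ 2); apply: wsos_term. Qed.

Lemma wsos_sqr u : K u -> wsos W K (u ^+ 2).
Proof. by move=> Ku; rewrite -[u ^+ 2]mul1r; apply: wsos_term. Qed.

Lemma wsosD x y : wsos W K x -> wsos W K y -> wsos W K (x + y).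
Proof.
move=> Wx; elim=> [|{}y w u _ Wxy Ww Ku]; first by rewrite addr0.
by rewrite addrA; constructor.
Qed.

Lemma wsosM x y : wsos W K x -> wsos W K y -> wsos W K (x * y).
Proof.
move=> Wx; elim=> [|{}y w u _ Wxy Ww Ku]; first by rewrite mulr0; constructor.
rewrite mulrDr; apply: wsosD => //.
elim: Wx {Wxy} => [|{}x v t _ Wxwu Wv Kt]; first by rewrite mul0r; constructor.
rewrite mulrDl; apply: wsosD => //.
have -> : v * t ^+ 2 * (w * u ^+ 2) = (v * w) * (t * u) ^+ 2 by ring.
by apply: wsos_term; [exact: WM|exact: KM].
Qed.

Lemma wsos_sum (qs : seq A) :
  (forall q, q \in qs -> K q) -> wsos W K (\sum_(q <- qs) q ^+ 2).
Proof.
elim: qs => [|q qs IHqs] Kqs; first by rewrite big_nil; constructor.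
rewrite big_cons; apply: wsosD.
  by apply/wsos_sqr/Kqs; rewrite mem_head.
by apply: IHqs => r rqs; apply: Kqs; rewrite in_cons rqs orbT.
Qed.

End WeightedSumsOfSquares.

Lemma sub_wsos (A : comNzRingType) (W K K' : set A) :
  K `<=` K' -> wsos W K `<=` wsos W K'.
Proof. by move=> KK' x; elim=> [|{}x w u _ Wx Ww /KK' K'u]; constructor. Qed.

Definition is_subfield (C : fieldType) (K : set C) : Prop :=
  [/\ K 1, forall x y, K x -> K y -> K (x - y) &
      forall x y, K x -> K y -> K (x / y)].

Section SubfieldType.
Variables (C : fieldType) (S : divringClosed C).

Record subfield_type : predArgType :=
  SubfieldElt { subfield_val : C; _ : subfield_val \in S }.

HB.instance Definition _ := [isSub for subfield_val].
HB.instance Definition _ := [Choice of subfield_type by <:].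
HB.instance Definition _ := [SubChoice_isSubIntegralDomain of subfield_type by <:].
HB.instance Definition _ := [SubIntegralDomain_isSubField of subfield_type by <:].

End SubfieldType.

Lemma subfield_pack (C : fieldType) (K : set C) : is_subfield K ->
  exists (L : fieldType) (v : {rmorphism L -> C}), range v = K.
Proof.
move=> [K1 KB KV].
pose Kb : {pred C} := fun x => `[< K x >].
have Kb_closed : divring_closed Kb.
  split; first exact/asboolP.
    by move=> x y /asboolP Kx /asboolP Ky; apply/asboolP/KB.
  by move=> x y /asboolP Kx /asboolP Ky; apply/asboolP/KV.
pose S : divringClosed C := HB.pack Kb (GRing.isDivringClosed.Build C Kb Kb_closed).
exists (subfield_type S), (\val : {rmorphism subfield_type S -> C}).
apply/seteqP; split=> [_ [x _ <-]|x Kx].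
  by have /asboolP := valP x.
have Sx : x \in S by exact/asboolP.
by exists (SubfieldElt Sx).
Qed.

(** * Subfields maximal among those where -1 is not a weighted sum of squares *)

Section MaximalSubfield.
Variables (A : comNzRingType) (T : set A) (C : closedFieldType).
Variable (h : {rmorphism A -> C}).
Hypothesis T_preo : preordering T.
Hypothesis T_real : forall s t, T t -> h (s ^+ 2 + t) = 0 -> h s = 0.

Local Notation W := (h @` T).

Lemma weights1 : W 1.
Proof. by exists 1; rewrite ?rmorph1 //; apply: preordering1. Qed.

Lemma weightsM x y : W x -> W y -> W (x * y).
Proof.
move=> [s Ts <-] [t Tt <-]; exists (s * t); last by rewrite rmorphM.
exact: preorderingM.
Qed.

(** A common denominator multiplies the numerators by squares only, so they stay in [T]. For
    [x = -1] this gives [h (s ^+ 2 + t) = 0], against [T_real]. *)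
Lemma wsos_fractions x :
  wsos W [set x | exists a s, h s != 0 /\ x = h a / h s] x ->
  exists t s, [/\ T t, h s != 0 & x = h t / h s ^+ 2].
Proof.
elim=> [|{}x _ _ _ [t [s [Tt s0 ->]]] [u Tu <-] [a [r [r0 ->]]]].
  by exists 0, 1; split; [exact: preordering0|rewrite rmorph1 oner_neq0|rewrite rmorph0 mul0r].
exists (t * r ^+ 2 + u * (a * s) ^+ 2), (s * r); split.
- by apply: preorderingD => //; apply: preorderingM => //; exact: preordering_sqr.
- by rewrite rmorphM mulf_neq0.
- by rewrite !(rmorphD, rmorphM, rmorphXn) /=; field; rewrite s0 r0.
Qed.

(** Zorn's lemma starts from the fraction field [K0] of the image of [h]. A weighted sum involves
    finitely many elements, hence lives in a single member of a chain. *)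
Lemma maximal_subfield : exists K : set C,
  [/\ is_subfield K, range h `<=` K, ~ wsos W K (-1) &
      forall K', is_subfield K' -> K `<=` K' -> ~ wsos W K' (-1) -> K' = K].
Proof.
pose P K := [/\ is_subfield K, range h `<=` K & ~ wsos W K (-1)].
pose K0 := [set x | exists a s, h s != 0 /\ x = h a / h s].
have hK0 : range h `<=` K0.
  by move=> _ [a _ <-]; exists a, 1; rewrite rmorph1 oner_neq0 divr1.
have PK0 : P K0.
  split=> //; first split.
  - by apply: hK0; exists 1; rewrite ?rmorph1.
  - move=> _ _ [a [s [s0 ->]]] [b [r [r0 ->]]].
    exists (a * r - b * s), (s * r); rewrite !(rmorphB, rmorphM) mulf_neq0 //.
    by split=> //; field; rewrite s0 r0.
  - move=> _ _ [a [s [s0 ->]]] [b [r [r0 ->]]].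
    have [b0|b0] := eqVneq (h b) 0.
      exists 0, 1; rewrite rmorph0 rmorph1 oner_neq0 b0.
      by rewrite !mul0r invr0 mulr0.
    exists (a * r), (s * b); rewrite !rmorphM mulf_neq0 //.
    by split=> //; field; rewrite s0 b0 r0.
  - move=> /wsos_fractions[t [s [Tt s0 eq1]]]; case/eqP: (s0).
    apply: (T_real Tt); rewrite rmorphD rmorphXn /=.
    have -> : h t = - h s ^+ 2.
      by rewrite -mulN1r eq1 divfK // expf_neq0.
    by rewrite subrr.
have [//|F [X FX] FP Ftot|K [[Kf hK Kn1] _ Kmax]] := @zorn_set C P K0; last first.
  exists K; split=> // K' K'f KK' K'n1; apply: Kmax => //; split=> //.
  exact: subset_trans KK'.
have two Y Z : F Y -> F Z -> exists V, [/\ F V, Y `<=` V & Z `<=` V].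
  by move=> FY FZ; have [YZ|ZY] := Ftot Y Z FY FZ; [exists Z|exists Y]; split.
split; first split.
- by exists X => //; have [[]] := FP X FX.
- move=> x y [Y FY Yx] [Z FZ Zy]; have [V [FV YV ZV]] := two Y Z FY FZ.
  exists V => //; have [[_ VB _] _ _] := FP V FV.
  by apply: VB; [exact: YV|exact: ZV].
- move=> x y [Y FY Yx] [Z FZ Zy]; have [V [FV YV ZV]] := two Y Z FY FZ.
  exists V => //; have [[_ _ VV] _ _] := FP V FV.
  by apply: VV; [exact: YV|exact: ZV].
- by move=> x hx; exists X => //; have [_ + _] := FP X FX; apply.
- have cup x : wsos W (\bigcup_(Y in F) Y) x -> exists2 Y, F Y & wsos W Y x.
    elim=> [|{}x w u _ [Y FY Yx] Ww [Z FZ Zu]]; first by exists X => //; constructor.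
    have [V [FV YV ZV]] := two Y Z FY FZ; exists V => //.
    by constructor => //; [exact: sub_wsos Yx|exact: ZV].
  by move=> /cup[Y FY]; have [_ _] := FP Y FY.
Qed.

End MaximalSubfield.

Section RealClosure.
Variables (A : comNzRingType) (T : set A) (C : closedFieldType).
Variable (h : {rmorphism A -> C}).
Hypothesis T_preo : preordering T.
Variables (K : set C) (L : fieldType) (v : {rmorphism L -> C}).
Hypotheses (K_field : is_subfield K) (vK : range v = K) (hK : range h `<=` K).
Hypothesis K_proper : ~ wsos (h @` T) K (-1).
Hypothesis K_max : forall K', is_subfield K' -> K `<=` K' ->
  ~ wsos (h @` T) K' (-1) -> K' = K.

Let WL : set L := [set a | (h @` T) (v a)].

Let WL1 : WL 1.
Proof. by rewrite /WL /= rmorph1; exact: weights1. Qed.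

Let WLM x y : WL x -> WL y -> WL (x * y).
Proof. by rewrite /WL /= rmorphM; exact: weightsM. Qed.

Let L_proper : ~ wsos WL setT (-1).
Proof.
move=> Ln1; apply: K_proper; rewrite -(rmorphN1 v).
elim: Ln1 => [|x w u _ Kx Ww _]; first by rewrite rmorph0; constructor.
by rewrite rmorphD rmorphM rmorphXn; constructor => //; rewrite -vK; exists u.
Qed.

Lemma irreducible_root_dvdp (p q : {poly L}) (z : C) : irreducible_poly p ->
  root (map_poly v p) z -> root (map_poly v q) z -> p %| q.
Proof.
move=> p_irr pz qz; apply: contrapT => /negP npq.
have cpq : coprimep p q.
  rewrite /coprimep; apply/eqP; apply: contrapT => /eqP g1.
  have [_ /(_ _ g1 (dvdp_gcdl p q)) gp] := p_irr.
  by move: npq; rewrite -(eqp_dvdl _ gp) dvdp_gcdr.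
have : coprimep (map_poly v p) (map_poly v q) by rewrite coprimep_map.
by move/coprimep_root => /(_ z pz); rewrite -rootE qz.
Qed.

(** The argument of Artin and Schreier: for a root [z] of [p], the field [K[z]] is strictly larger
    than [K], so maximality makes -1 a weighted sum of squares there. Lifting to polynomials and
    reducing modulo [p] gives [r] with the bound on sizes. *)
Lemma irreducible_adjoin (p : {poly L}) :
    irreducible_poly p -> (forall x, ~~ root p x) ->
  exists2 r : {poly L}, wsos (polyC @` WL) [set q | (size q < size p)%N] r & p %| 1 + r.
Proof.
move=> p_irr p_noroot; have [sz_p _] := p_irr.
have p0 : p != 0 by rewrite -size_poly_gt0 ltnW.
have [z pz] : exists z, root (map_poly v p) z.
  by apply/closed_rootP; rewrite size_map_poly neq_ltn sz_p orbT.
pose K' : set C := [set y | exists q : {poly L}, y = (map_poly v q).[z]].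
have KK' : K `<=` K'.
  by rewrite -vK => _ [a _ <-]; exists a%:P; rewrite map_polyC hornerC.
have K'z : K' z by exists 'X; rewrite map_polyX hornerX.
have nKz : ~ K z.
  rewrite -vK => -[a _ az]; move: pz; rewrite -az => /rootP.
  by rewrite horner_map /= => /eqP; rewrite fmorph_eq0; apply/negP/p_noroot.
have K'_field : is_subfield K'.
  split.
  - by exists 1; rewrite rmorph1 hornerC.
  - by move=> _ _ [q ->] [r ->]; exists (q - r); rewrite rmorphB hornerD hornerN.
  - move=> _ _ [q ->] [r ->].
    have [rz|rz] := eqVneq (map_poly v r).[z] 0.
      by exists 0; rewrite rz invr0 mulr0 rmorph0 horner0.
    have cpr : coprimep p r.
      rewrite /coprimep; apply/eqP; apply: contrapT => /eqP g1.
      have [_ /(_ _ g1 (dvdp_gcdl p r)) gp] := p_irr.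
      have : p %| r by rewrite -(eqp_dvdl _ gp) dvdp_gcdr.
      move/dvdpP => [s rE]; case/eqP: rz.
      by rewrite rE rmorphM hornerM (rootP pz) mulr0.
    have /Bezout_eq1_coprimepP[[s t] /= bezout] := cpr.
    exists (q * t); rewrite rmorphM hornerM; congr (_ * _).
    apply: (mulIf rz); rewrite mulVf //.
    have := congr1 (fun w : {poly L} => (map_poly v w).[z]) bezout.
    rewrite rmorphD !rmorphM hornerD !hornerM (rootP pz) mulr0 add0r => ->.
    by rewrite rmorph1 hornerC.
have K'n1 : wsos (h @` T) K' (-1).
  by apply: contrapT => /(K_max K'_field KK') K'E; apply: nKz; rewrite -K'E.
have [r Wr rz] : exists2 r : {poly L}, wsos (polyC @` WL) [set q | (size q < size p)%N] r &
    (map_poly v r).[z] = -1.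
  elim: K'n1 => [|_ w u _ [r Wr <-] [t Tt <-] [q ->]].
    by exists 0; [constructor|rewrite rmorph0 horner0].
  have [a _ vat] : range v (h t) by rewrite vK; apply: hK; exists t.
  exists (r + a%:P * (q %% p) ^+ 2).
    constructor => //; last by rewrite /= ltn_modp.
    by exists a => //; exists t.
  rewrite rmorphD rmorphM rmorphXn /= map_polyC hornerD hornerM horner_exp hornerC /= vat.
  congr (_ + _ * _ ^+ 2); rewrite [in RHS](divp_eq q p) rmorphD rmorphM.
  by rewrite hornerD hornerM (rootP pz) mulr0 add0r.
exists r => //; apply: irreducible_root_dvdp pz _ => //.
by rewrite rootE rmorphD rmorph1 hornerD hornerC rz subrr.
Qed.

(** For [p = 'X^2 - x%:P] the squared polynomials are at most linear, so [1 + r] is a constant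
    multiple of [p]. With [s] and [t] the coefficients of [r] in degrees 0 and 2, comparison gives
    [1 + s = - t * x]. *)
Lemma nonsquare_weights x : (forall y, x != y ^+ 2) ->
  exists s t, [/\ wsos WL setT s, wsos WL setT t & 1 + s + t * x = 0].
Proof.
move=> x_nsq; pose p : {poly L} := 'X^2 - x%:P.
have sz_p : size p = 3%N by rewrite size_XnsubC.
have p_noroot y : ~~ root p y.
  by rewrite rootE !hornerE subr_eq0 eq_sym.
have p_irr : irreducible_poly p by apply: cubic_irreducible; rewrite ?sz_p.
have [r Wr] := irreducible_adjoin p_irr p_noroot.
have [s [t [b [Ws Wt rE]]]] : exists s t b, [/\ wsos WL setT s, wsos WL setT t &
    r = s%:P + b *: 'X + t *: 'X^2].
  elim: Wr => [|{}r _ q0 _ [s [t [b [Ws Wt ->]]]] [a Wa <-] /=].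
    by exists 0, 0, 0; split; [constructor|constructor|rewrite !scale0r !addr0].
  pose q : {poly L} := q0; rewrite sz_p -[q0]/q => sz_q.
  have -> : q = (q`_0)%:P + q`_1 *: 'X.
    apply/polyP => -[|[|i]]; rewrite coefD coefC coefZ coefX ?mulr0 ?mulr1 ?addr0 ?add0r //.
    by rewrite nth_default // (leq_trans (ltnSE sz_q)).
  exists (s + a * q`_0 ^+ 2), (t + a * q`_1 ^+ 2), (b + a * (2 * q`_0 * q`_1)).
  split; [by constructor|by constructor|].
  rewrite -!mul_polyC !(polyCD, polyCM, rmorphXn) /=.
  by rewrite ?polyC1; ring.
have sz_r : (size (1 + r)%R <= 3)%N.
  apply: leq_trans (size_polyD _ _) _; rewrite size_poly1 geq_max /=.
  rewrite rE; apply: leq_trans (size_polyD _ _) _; rewrite geq_max.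
  rewrite (leq_trans (size_scale_leq _ _)) ?size_polyXn // andbT.
  apply: leq_trans (size_polyD _ _) _; rewrite geq_max.
  rewrite (leq_trans (size_polyC_leq1 _)) //.
  by rewrite (leq_trans (size_scale_leq _ _)) ?size_polyX.
move/dvdpP => [c cE].
have [d dE] : exists d, c = d%:P.
  have [->|c0] := eqVneq c 0; first by exists 0.
  have : size c = 1%N.
    have p0 : p != 0 by rewrite -size_poly_gt0 sz_p.
    have c1 : (0 < size c)%N by rewrite size_poly_gt0.
    have arith i : ((i + 3).-1 <= 3 -> 0 < i -> i = 1)%N by lia.
    by have := sz_r; rewrite cE size_mul // sz_p => /arith; apply.
  by move/eqP/size_poly1P => [d _ ->]; exists d.
exists s, t; split=> //.
have coef0 := congr1 (fun q : {poly L} => q`_0) cE.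
have coef2 := congr1 (fun q : {poly L} => q`_2) cE.
move: coef0 coef2; rewrite dE rE mul_polyC !(coefD, coefZ, coefN, coefC, coefX, coefXn, coef1) /=.
rewrite !(mulr0, mulr1, addr0, add0r, oppr0) => -> ->.
by ring.
Qed.

(** Otherwise [-1 = s + t * x] would itself be a weighted sum of squares. *)
Lemma weight_square x : wsos WL setT x -> exists y, x = y ^+ 2.
Proof.
move=> Wx; apply: contrapT => x_nsq.
have [|s [t [Ws Wt st0]]] := @nonsquare_weights x.
  by move=> y; apply/eqP => xy; apply: x_nsq; exists y.
apply: L_proper; have -> : -1 = s + t * x.
  by apply/eqP; rewrite eq_sym -subr_eq0 opprK addrC addrA st0.
by apply: wsosD => //; apply: wsosM.
Qed.

(** A nonsquare [x] satisfies [1 + s + t * x = 0] with [t != 0], so [- x] is a weighted sum of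
    squares, hence a square. Since weights are squares too, [irreducible_adjoin] provides the plain
    sums of squares that [rcf_of_squares] asks for. *)
Lemma maximal_subfield_rcf : exists F : rcfType, inhabited {rmorphism L -> F}.
Proof.
apply: rcf_of_squares.
- move=> x; have [[y xy]|x_nsq] := pselect (exists y, x = y ^+ 2).
    by exists y; left.
  have [|s [t [Ws Wt st0]]] := @nonsquare_weights x.
    by move=> y; apply/eqP => xy; apply: x_nsq; exists y.
  have t0 : t != 0.
    apply/eqP => t0; apply: L_proper; have -> : -1 = s => //.
    apply/eqP; rewrite eq_sym -subr_eq0 opprK addrC.
    by move: st0; rewrite t0 mul0r addr0 => ->.
  have [|y xy] := @weight_square (- x).
    have -> : - x = (1 + s) * t * (t^-1) ^+ 2.
      apply: (mulfI t0); rewrite mulrN; have -> : t * x = - (1 + s).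
        by apply/eqP; rewrite -subr_eq0 opprK addrC st0.
      by field.
    apply: wsosM => //; last by apply: wsos_sqr.
    by apply: wsosM => //; apply: wsosD => //; apply: wsos_weight.
  by exists y; right; rewrite -xy opprK.
- move=> qs; apply/eqP => qs0; apply: L_proper.
  have -> : -1 = \sum_(q <- qs) q ^+ 2.
    by apply/eqP; rewrite eq_sym -subr_eq0 opprK addrC qs0.
  exact: wsos_sum.
- move=> p p_irr p_noroot; have [r Wr pr] := irreducible_adjoin p_irr p_noroot.
  suff [qs szqs rE] : exists2 qs : seq {poly L},
      (forall q, q \in qs -> (size q < size p)%N) & r = \sum_(q <- qs) q ^+ 2.
    by exists qs; rewrite -?rE.
  elim: Wr => [|_ _ q _ [qs szqs ->] [a Wa <-] sz_q]; first by exists [::]; rewrite ?big_nil.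
  have [c cE] : exists c, a = c ^+ 2 by apply: weight_square; apply: wsos_weight.
  exists (c *: q :: qs).
    move=> u; rewrite in_cons => /predU1P[->|]; last exact: szqs.
    exact: leq_ltn_trans (size_scale_leq _ _) sz_q.
  by rewrite big_cons addrC exprZn -mul_polyC -cE.
Qed.

End RealClosure.

(** The morphism [h] factors through [L], where the members of [T] become weights and therefore
    squares; the order of [F] then has no choice. *)
Lemma real_closed_point (A : comNzRingType) (f : A -> nat) (T : set A) :
    injective f -> preordering T -> ~ T (-1) ->
  exists (F : rcfType) (h : {rmorphism A -> F}), forall t, T t -> 0 <= h t.
Proof.
move=> f_inj T_preo Tn1.
have [I [I_ideal I1 I_prime I_real]] := preordering_prime_ideal T_preo Tn1.
have [C [h hI]] := prime_ideal_closed_hom f_inj I_ideal I1 I_prime.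
have T_real s t : T t -> h (s ^+ 2 + t) = 0 -> h s = 0.
  by move=> Tt /hI /(I_real _ _ Tt) /hI.
have [K [K_field hK K_proper K_max]] := maximal_subfield T_preo T_real.
have [L [v vK]] := subfield_pack K_field.
have [F [u]] := maximal_subfield_rcf T_preo vK hK K_proper K_max.
have lift a : {b | v b = h a}.
  by apply: cid; have [b _ vb] : range v (h a) by [rewrite vK; apply: hK; exists a]; exists b.
pose g a := sval (lift a).
have gE a : v (g a) = h a by rewrite /g; case: (lift a).
have g_add : zmod_morphism g.
  by move=> a b; apply: (fmorph_inj v); rewrite rmorphB !gE rmorphB.
have g_mul : monoid_morphism g.
  split; first by apply: (fmorph_inj v); rewrite gE !rmorph1.
  by move=> a b; apply: (fmorph_inj v); rewrite rmorphM !gE rmorphM.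
pose G : {rmorphism A -> L} := HB.pack g (GRing.isZmodMorphism.Build A L g g_add)
  (GRing.isMonoidMorphism.Build A L g g_mul).
exists F, (u \o G) => t Tt /=.
have [|y ->] := @weight_square A T C h T_preo K L v vK hK K_proper K_max (g t).
  apply: wsos_weight => //; rewrite /= gE; by exists t.
by rewrite rmorphXn sqr_ge0.
Qed.

(** * Transfer between real closed fields *)

Section QETransfer.
Import qe_rcf_th qe_rcf.

(** * Quantifier elimination commutes with a change of the field of constants *)

Section Naturality.
Variables (k : realFieldType) (F : realFieldType) (phi : {rmorphism k -> F}).
Implicit Types (p q : polyF k) (t : term k).

Fixpoint map_term (t : term k) : term F :=
  match t with
  | Var i => Var F i
  | Const c => Const (phi c)
  | NatConst n => NatConst F n
  | Add u v => Add (map_term u) (map_term v)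
  | Opp u => Opp (map_term u)
  | NatMul u n => NatMul (map_term u) n
  | Mul u v => Mul (map_term u) (map_term v)
  | Exp u n => Exp (map_term u) n
  end.

Fixpoint map_formula (f : formula k) : formula F :=
  match f with
  | Bool b => Bool b
  | Equal u v => Equal (map_term u) (map_term v)
  | Lt u v => Lt (map_term u) (map_term v)
  | Le u v => Le (map_term u) (map_term v)
  | And f g => And (map_formula f) (map_formula g)
  | Or f g => Or (map_formula f) (map_formula g)
  | Implies f g => Implies (map_formula f) (map_formula g)
  | Not f => Not (map_formula f)
  end.

Notation mp := (map map_term).
Notation mf := map_formula.

(** The elimination procedure is written with continuations, so this lemma and the next ones assume
    that the continuations correspond under [map_formula] and conclude that the resulting formulas
    do. *)
Lemma map_Size p K K' : (forall n, mf (K n) = K' n) ->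
  mf (Size p K) = Size (mp p) K'.
Proof.
elim: p K K' => [|c p IHp] K K' eqK /=; first exact: eqK.
by apply: IHp => -[|n] /=; rewrite ?eqK.
Qed.

Lemma map_Isnull p K K' : (forall b, mf (K b) = K' b) ->
  mf (Isnull p K) = Isnull (mp p) K'.
Proof. by move=> eqK; apply: map_Size => n; apply: eqK. Qed.

Lemma map_LtSize p q K K' : (forall b, mf (K b) = K' b) ->
  mf (LtSize p q K) = LtSize (mp p) (mp q) K'.
Proof. by move=> eqK; apply: map_Size => n; apply: map_Size => m; apply: eqK. Qed.

Lemma map_LeadCoef p K K' : (forall t, mf (K t) = K' (map_term t)) ->
  mf (LeadCoef p K) = LeadCoef (mp p) K'.
Proof.
elim: p K K' => [|c p IHp] K K' eqK /=; first by rewrite eqK /= rmorph0.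
by apply: IHp => l /=; rewrite !eqK.
Qed.

Lemma map_AmulXn t n : mp (AmulXn t n) = AmulXn (map_term t) n.
Proof. by elim: n => //= n ->; rewrite rmorph0. Qed.

Lemma map_AddPoly p q : mp (AddPoly p q) = AddPoly (mp p) (mp q).
Proof. by elim: p q => [|a p IHp] [|b q] //=; rewrite IHp. Qed.

Lemma map_ScalPoly t p : mp (ScalPoly t p) = ScalPoly (map_term t) (mp p).
Proof. by rewrite /ScalPoly -!map_comp. Qed.

Lemma map_MulPoly p q : mp (MulPoly p q) = MulPoly (mp p) (mp q).
Proof. by elim: p => //= a p IHp; rewrite map_AddPoly map_ScalPoly /= IHp. Qed.

Lemma map_ExpPoly p n : mp (ExpPoly p n) = ExpPoly (mp p) n.
Proof.
rewrite /ExpPoly; case: n => // n; rewrite !iteropS.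
by elim: n => //= n IHn; rewrite map_MulPoly IHn.
Qed.

Lemma map_OppPoly p : mp (OppPoly p) = OppPoly (mp p).
Proof. by rewrite /OppPoly map_ScalPoly /= rmorphN1. Qed.

Lemma map_NatMulPoly n p : mp (NatMulPoly n p) = NatMulPoly n (mp p).
Proof. by rewrite /NatMulPoly map_ScalPoly. Qed.

Lemma map_Deriv p : mp (Deriv p) = Deriv (mp p).
Proof. by elim: p => //= a p IHp; rewrite map_AddPoly /= IHp. Qed.

Definition map_OpPoly := (map_AmulXn, map_AddPoly, map_MulPoly, map_ScalPoly,
  map_ExpPoly, map_OppPoly, map_NatMulPoly, map_Deriv).

Lemma map_Rediv_rec_loop q sq cq c qq r n K K' :
  (forall d u v, mf (K (d, u, v)) = K' (d, mp u, mp v)) ->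
  mf (Rediv_rec_loop q sq cq c qq r n K)
  = Rediv_rec_loop (mp q) sq (map_term cq) c (mp qq) (mp r) n K'.
Proof.
elim: n c qq r K K' => [|n IHn] c qq r K K' eqK /=.
  apply: map_Size => sr; case: ifP => _; first exact: eqK.
  by apply: map_LeadCoef => lr; rewrite eqK !map_OpPoly /= .
apply: map_Size => sr; case: ifP => _; first exact: eqK.
by apply: map_LeadCoef => lr; rewrite (IHn _ _ _ _ K') // !map_OpPoly /=.
Qed.

Lemma map_Rediv p q K K' :
  (forall d u v, mf (K (d, u, v)) = K' (d, mp u, mp v)) ->
  mf (Rediv p q K) = Rediv (mp p) (mp q) K'.
Proof.
move=> eqK; apply: map_Isnull => -[]; first by rewrite eqK /= rmorph0.
apply: map_Size => sq; apply: map_Size => sp; apply: map_LeadCoef => lq.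
by rewrite (map_Rediv_rec_loop _ _ _ _ _ _ _ eqK) /= rmorph0.
Qed.

Lemma map_Rmod p q K K' : (forall r, mf (K r) = K' (mp r)) ->
  mf (Rmod p q K) = Rmod (mp p) (mp q) K'.
Proof. by move=> eqK; apply: map_Rediv => d u v; apply: eqK. Qed.

Lemma map_Rgcd_loop n p q K K' : (forall r, mf (K r) = K' (mp r)) ->
  mf (Rgcd_loop n p q K) = Rgcd_loop n (mp p) (mp q) K'.
Proof.
move=> eqK; elim: n p q => [|n IHn] p q /=; apply: map_Rmod => r;
  by apply: map_Isnull => -[]; rewrite ?eqK.
Qed.

Lemma map_Rgcd p q K K' : (forall r, mf (K r) = K' (mp r)) ->
  mf (Rgcd p q K) = Rgcd (mp p) (mp q) K'.
Proof.
move=> eqK; apply: map_LtSize => -[]; apply: map_Isnull => -[];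
  by rewrite ?eqK //; apply: map_Size => n; apply: map_Rgcd_loop.
Qed.

Lemma map_BigRgcd ps K K' : (forall r, mf (K r) = K' (mp r)) ->
  mf (BigRgcd ps K) = BigRgcd (map mp ps) K'.
Proof.
elim: ps K K' => [|p ps IHps] K K' eqK /=; first by rewrite eqK /= rmorph0.
by apply: IHps => r; apply: map_Rgcd.
Qed.

Lemma map_Changes (s : seq (term k)) K K' : (forall n, mf (K n) = K' n) ->
  mf (Changes s K) = Changes (mp s) K'.
Proof.
elim: s K K' => [|a s IHs] K K' eqK /=; first exact: eqK.
by apply: IHs => v /=; rewrite !eqK; case: (s).
Qed.

Lemma map_SeqPInfty ps K K' : (forall s, mf (K s) = K' (mp s)) ->
  mf (SeqPInfty ps K) = SeqPInfty (map mp ps) K'.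
Proof.
elim: ps K K' => [|p ps IHps] K K' eqK /=; first exact: eqK.
by apply: map_LeadCoef => l; apply: IHps => s; rewrite eqK.
Qed.

Lemma map_SeqMInfty ps K K' : (forall s, mf (K s) = K' (mp s)) ->
  mf (SeqMInfty ps K) = SeqMInfty (map mp ps) K'.
Proof.
elim: ps K K' => [|p ps IHps] K K' eqK /=; first exact: eqK.
apply: map_LeadCoef => l; apply: map_Size => sp; apply: IHps => s.
by rewrite eqK /= rmorphN1.
Qed.

Lemma map_ChangesPoly ps K K' : (forall z, mf (K z) = K' z) ->
  mf (ChangesPoly ps K) = ChangesPoly (map mp ps) K'.
Proof.
move=> eqK; apply: map_SeqMInfty => m; apply: map_SeqPInfty => s.
by apply: map_Changes => u; apply: map_Changes => v; apply: eqK.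
Qed.

Lemma map_NextMod p q K K' : (forall r, mf (K r) = K' (mp r)) ->
  mf (NextMod p q K) = NextMod (mp p) (mp q) K'.
Proof.
move=> eqK; apply: map_LeadCoef => l; apply: map_Rediv => d _ _ /=.
by apply: map_Rmod => r; rewrite eqK map_ScalPoly.
Qed.

Lemma map_ModsAux p q n K K' : (forall r, mf (K r) = K' (map mp r)) ->
  mf (ModsAux p q n K) = ModsAux (mp p) (mp q) n K'.
Proof.
elim: n p q K K' => [|n IHn] p q K K' eqK /=; first exact: eqK.
apply: map_Isnull => -[]; first exact: eqK.
by apply: map_NextMod => r; apply: IHn => s; rewrite eqK.
Qed.

Lemma map_Mods p q K K' : (forall r, mf (K r) = K' (map mp r)) ->
  mf (Mods p q K) = Mods (mp p) (mp q) K'.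
Proof. by move=> eqK; do 2!apply: map_Size => ?; apply: map_ModsAux. Qed.

Lemma map_PolyComb (sq : seq (polyF k)) sc :
  mp (PolyComb sq sc) = PolyComb (map mp sq) sc.
Proof.
rewrite /PolyComb size_map; elim: (iota _ _) => //= i s IHs.
rewrite map_MulPoly IHs map_ExpPoly; congr (MulPoly (ExpPoly _ _) _).
have [i_sq|sq_i] := ltnP i (size sq); first by rewrite (nth_map [::]).
by rewrite !nth_default ?size_map.
Qed.

Lemma map_Pcq sq i : mp (Pcq sq i) = Pcq (map mp sq) i.
Proof.
rewrite /Pcq size_map; elim: (sg_tab _) i => [|s l IHl] [|i] //=.
exact: map_PolyComb.
Qed.

Lemma map_TaqR p q K K' : (forall z, mf (K z) = K' z) ->
  mf (TaqR p q K) = TaqR (mp p) (mp q) K'.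
Proof.
move=> eqK; rewrite /TaqR -map_Deriv -map_MulPoly.
by apply: map_Mods => r; apply: map_ChangesPoly.
Qed.

Lemma map_TaqsR p sq i K K' : (forall t, mf (K t) = K' (map_term t)) ->
  mf (TaqsR p sq i K) = TaqsR (mp p) (map mp sq) i K'.
Proof.
move=> eqK; rewrite /TaqsR -map_Pcq; apply: map_TaqR => z.
by rewrite eqK /= rmorph_int.
Qed.

Lemma map_BoundingPoly sq : mp (BoundingPoly sq) = BoundingPoly (map mp sq).
Proof.
rewrite /BoundingPoly map_Deriv; congr Deriv.
by elim: sq => //= p sq IHsq; rewrite map_MulPoly IHsq.
Qed.

(** These numbers are entries of the inverse of an integer matrix, and inversion of matrices
    commutes with field morphisms. *)
Lemma map_coefs n i : phi (coefs k n i) = coefs F n i.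
Proof.
rewrite /coefs; have [lt_i|le_i] := ltnP i (3 ^ n); last first.
  by rewrite !nth_default ?rmorph0 // size_map size_enum_ord.
rewrite !(nth_map (Ordinal lt_i)) -?enumT ?size_enum_ord // !castmxE /=.
have -> (M : 'M[k]_(3 ^ n)) u v : phi (M u v) = map_mx phi M u v by rewrite mxE.
rewrite map_invmx -map_mx_comp; congr (invmx _ _ _).
by apply/matrixP => u v; rewrite !mxE /= rmorph_int.
Qed.

Lemma map_Coefs n i : map_term (Coefs k n i) = Coefs F n i.
Proof.
rewrite /Coefs /=; congr Const; case: n => [|[|n]].
- by rewrite rmorph_nat.
- by case: i => [|[|[|i]]] /=; rewrite ?nth_nil ?rmorph0 ?fmorphV ?rmorph_nat.
- exact: map_coefs.
Qed.

Lemma map_CcountWeak p sq K K' : (forall t, mf (K t) = K' (map_term t)) ->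
  mf (CcountWeak p sq K) = CcountWeak (mp p) (map mp sq) K'.
Proof.
move=> eqK; rewrite /CcountWeak size_map.
have -> : NatConst F 0 = map_term (NatConst k 0) by [].
elim: (3 ^ _)%N (NatConst k 0) => [|n IHn] t /=; first exact: eqK.
by apply: map_TaqsR => u; rewrite IHn -map_Coefs.
Qed.

Lemma map_CcountGt0 sp sq :
  mf (CcountGt0 sp sq) = CcountGt0 (map mp sp) (map mp sq).
Proof.
apply: map_BigRgcd => p; apply: map_Isnull => -[] /=; last first.
  exact: map_CcountWeak.
rewrite -map_BoundingPoly; apply: map_CcountWeak => t /=.
congr (Or _ (Or _ _)).
  elim: sq => //= q sq ->; congr And.
  exact: map_LeadCoef.
elim: sq => //= q sq ->; congr And.
by apply: map_Size => n; apply: map_LeadCoef.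
Qed.

Lemma map_abstrX i t : mp (abstrX i t) = abstrX i (map_term t).
Proof.
elim: t => //=.
- by move=> n; case: ifP.
- by move=> u IHu v IHv; rewrite map_AddPoly IHu IHv.
- by move=> u IHu; rewrite map_OppPoly IHu.
- by move=> u IHu n; rewrite map_NatMulPoly IHu.
- by move=> u IHu v IHv; rewrite map_MulPoly IHu IHv.
- by move=> u IHu n; rewrite map_ExpPoly IHu.
Qed.

End Naturality.

(** * Uniform elimination over an ordered field, and transfer *)

Section Elimination.
Variable k : realFieldType.

Notation clause := (seq (term k) * seq (term k))%type.

(** A clause lists terms required to vanish and terms required to be positive, which is the input
    format of [CcountGt0]. *)
Definition eval_dnf (cs : seq clause) (F : realFieldType)
    (phi : {rmorphism k -> F}) (e : seq F) : bool :=
  has (fun c : clause => all (fun t => eval e (map_term phi t) == 0) c.1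
                      && all (fun t => 0 < eval e (map_term phi t)) c.2) cs.

Definition and_dnf (cs cs' : seq clause) : seq clause :=
  [seq (c.1 ++ c'.1, c.2 ++ c'.2) | c <- cs, c' <- cs'].

Lemma eval_dnf_and (cs cs' : seq clause) (F : realFieldType)
    (phi : {rmorphism k -> F}) (e : seq F) :
  eval_dnf (and_dnf cs cs') phi e
  = eval_dnf cs phi e && eval_dnf cs' phi e.
Proof.
rewrite /eval_dnf; elim: cs => //= c cs IHcs; rewrite has_cat IHcs has_map.
rewrite andb_orl; congr orb; elim: cs' {IHcs} => /= [|c' cs' ->].
  by rewrite andbF.
by rewrite andb_orr !all_cat andbACA.
Qed.

(** The list [cs] is chosen before [F] and [phi], since one normal form must serve all fields over
    [k]. Clauses have no negation, so the induction treats [f] together with its negation. *)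
Lemma formula_dnf (f : formula k) :
  exists cs : seq clause, forall (F : realFieldType) (phi : {rmorphism k -> F}) e,
    qf_eval e (map_formula phi f) = eval_dnf cs phi e.
Proof.
suff [] : (exists cs : seq clause,
    forall (F : realFieldType) (phi : {rmorphism k -> F}) e,
    qf_eval e (map_formula phi f) = eval_dnf cs phi e) /\
  (exists cs : seq clause,
    forall (F : realFieldType) (phi : {rmorphism k -> F}) e,
    ~~ qf_eval e (map_formula phi f) = eval_dnf cs phi e) by [].
elim: f => [b|u v|u v|u v|f [[c cE] [d dE]] g [[c' c'E] [d' d'E]]
  |f [[c cE] [d dE]] g [[c' c'E] [d' d'E]]
  |f [[c cE] [d dE]] g [[c' c'E] [d' d'E]]|f [[c cE] [d dE]]].
- split; [exists (if b then [:: ([::], [::])] else [::])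
         |exists (if b then [::] else [:: ([::], [::])])];
  by move=> F phi e; case: b.
- split; [exists [:: ([:: Add u (Opp v)], [::])]
         |exists [:: ([::], [:: Add u (Opp v)]); ([::], [:: Add v (Opp u)])]];
  move=> F phi e; rewrite /eval_dnf /= ?andbT ?orbF ?subr_eq0 //.
  by rewrite !subr_gt0 neq_lt orbC.
- split; [exists [:: ([::], [:: Add v (Opp u)])]
         |exists [:: ([:: Add u (Opp v)], [::]); ([::], [:: Add u (Opp v)])]];
  move=> F phi e; rewrite /eval_dnf /= ?andbT ?orbF ?subr_eq0 ?subr_gt0 //.
  by rewrite -leNgt le_eqVlt eq_sym.
- split; [exists [:: ([:: Add u (Opp v)], [::]); ([::], [:: Add v (Opp u)])]
         |exists [:: ([::], [:: Add u (Opp v)])]];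
  move=> F phi e; rewrite /eval_dnf /= ?andbT ?orbF ?subr_eq0 ?subr_gt0 //.
  + by rewrite le_eqVlt.
  + by rewrite -ltNge.
- split; first by exists (and_dnf c c') => F phi e; rewrite eval_dnf_and -cE -c'E.
  exists (d ++ d') => F phi e.
  by rewrite /eval_dnf has_cat -/(eval_dnf _ _ _) -dE -[has _ _]d'E negb_and.
- split; last by exists (and_dnf d d') => F phi e; rewrite eval_dnf_and -dE -d'E /= negb_or.
  exists (c ++ c') => F phi e.
  by rewrite /eval_dnf has_cat -/(eval_dnf _ _ _) -cE -[has _ _]c'E.
- split; last by exists (and_dnf c d') => F phi e; rewrite eval_dnf_and -cE -d'E /= negb_imply.
  exists (d ++ c') => F phi e.
  by rewrite /eval_dnf has_cat -/(eval_dnf _ _ _) -dE -[has _ _]c'E /= implybE.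
- by split; [exists d|exists c] => F phi e /=; rewrite ?negbK.
Qed.

Lemma set_nth_size (T : Type) (x0 : T) (s : seq T) x :
  set_nth x0 s (size s) x = rcons s x.
Proof. by elim: s => //= y s ->. Qed.

(** The existential distributes over the disjunction of clauses, and naturality of [CcountGt0] lets
    a single [g] over [k] answer for every real closed [F]. *)
Lemma eliminate_var (n : nat) (f : formula k) :
  exists g : formula k, forall (F : rcfType) (phi : {rmorphism k -> F}) e,
    (exists x, qf_eval (set_nth 0 e n x) (map_formula phi f))
    <-> qf_eval e (map_formula phi g).
Proof.
have [cs csE] := formula_dnf f.
pose proj (c : clause) := CcountGt0 (map (abstrX n) c.1) (map (abstrX n) c.2).
exists (foldr (fun c => Or (proj c)) (Bool false) cs) => F phi e.
under eq_exists => x do rewrite csE.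
rewrite /eval_dnf; elim: cs {csE} => [|c cs IHcs] /=; first by split => // -[].
rewrite /proj map_CcountGt0 eval_CcountGt0 -!map_comp.
have -> (ts : seq (term k)) :
    map (eval_poly e \o (map (map_term phi) \o abstrX n)) ts
    = map (fun t => eval_poly e (abstrX n (map_term phi t))) ts.
  by apply: eq_map => t /=; rewrite map_abstrX.
split=> [[x /orP[cx|csx]]|/orP[/ccount_gt0P[x]|]].
- apply/orP; left; apply/ccount_gt0P; exists x.
  rewrite !big_all !all_map; move: cx; congr (_ && _);
  by apply: eq_all => t /=; rewrite ?map_abstrX abstrXP.
- by apply/orP; right; apply/IHcs; exists x.
- rewrite !big_all !all_map => cx; exists x; apply/orP; left; move: cx.
  by congr (_ && _); apply: eq_all => t /=; rewrite ?map_abstrX abstrXP.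
- by move/IHcs => [x csx]; exists x; rewrite csx orbT.
Qed.

Lemma eliminate_vars (n : nat) (f : formula k) :
  exists g : formula k, forall (F : rcfType) (phi : {rmorphism k -> F}),
    (exists2 v : seq F, size v = n & qf_eval v (map_formula phi f))
    <-> qf_eval [::] (map_formula phi g).
Proof.
elim: n f => [|n IHn] f.
  exists f => F phi; split=> [[v /size0nil ->]|?] //; by exists [::].
have [g gE] := eliminate_var n f; have [h hE] := IHn g.
exists h => F phi; rewrite -hE; split.
  case=> v; case/lastP: v => // v x; rewrite size_rcons => -[vn] fv.
  by exists v => //; apply/gE; exists x; rewrite -vn set_nth_size.
case=> v vn /gE[x fx]; exists (rcons v x); first by rewrite size_rcons vn.
by rewrite -(set_nth_size 0) vn.
Qed.

Lemma eval_closed (F : realFieldType) (phi : {rmorphism k -> F}) t :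
  eval [::] (map_term phi t) = phi (eval [::] t).
Proof.
elim: t => //=.
- by move=> i; rewrite !nth_nil rmorph0.
- by move=> n; rewrite rmorph_nat.
- by move=> u -> v ->; rewrite rmorphD.
- by move=> u ->; rewrite rmorphN.
- by move=> u -> n; rewrite rmorphMn.
- by move=> u -> v ->; rewrite rmorphM.
- by move=> u -> n; rewrite rmorphXn.
Qed.

Lemma qf_eval_closed (F : realFieldType) (phi : {rmorphism k -> F}) f :
  {mono phi : x y / x <= y} ->
  qf_eval [::] (map_formula phi f) = qf_eval [::] f.
Proof.
move=> phi_mono; have phi_ltr := leW_mono phi_mono.
elim: f => //=.
- by move=> u v; rewrite !eval_closed (inj_eq (fmorph_inj phi)).
- by move=> u v; rewrite !eval_closed phi_ltr.
- by move=> u v; rewrite !eval_closed phi_mono.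
- by move=> f -> g ->.
- by move=> f -> g ->.
- by move=> f -> g ->.
- by move=> f ->.
Qed.

(** Elimination leaves a formula over [k] read in the empty environment. Order embeddings preserve
    its truth value, so [F1] and [F2] both agree with [k]. *)
Lemma qf_transfer (n : nat) (f : formula k) (F1 F2 : rcfType)
    (phi1 : {rmorphism k -> F1}) (phi2 : {rmorphism k -> F2}) :
    {mono phi1 : x y / x <= y} -> {mono phi2 : x y / x <= y} ->
  (exists2 v, size v = n & qf_eval v (map_formula phi1 f)) ->
  exists2 v, size v = n & qf_eval v (map_formula phi2 f).
Proof.
move=> mono1 mono2; have [g gE] := eliminate_vars n f => /gE.
by rewrite qf_eval_closed // -(@qf_eval_closed _ phi2) // => /gE.
Qed.

Definition mpoly_term (n : nat) (p : mpoly.mpoly n k) : term k :=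
  foldr (fun m t => Add (Mul (Const (mpoly.mcoeff m p))
    (foldr (fun i u => Mul (Exp (Var k (val i)) (mpoly.fun_of_multinom m i)) u)
       (NatConst k 1) (enum 'I_n))) t) (NatConst k 0) (mpoly.msupp p).

Lemma eval_mpoly_term (n : nat) (p : mpoly.mpoly n k) (F : realFieldType)
    (phi : {rmorphism k -> F}) (v : seq F) :
  eval v (map_term phi (mpoly_term p))
  = mpoly.meval (fun i : 'I_n => v`_i) (mpoly.map_mpoly phi p).
Proof.
rewrite [in RHS](mpoly.mpolyE p) (rmorph_sum (mpoly.map_mpoly phi)) rmorph_sum.
rewrite /mpoly_term.
elim: (mpoly.msupp p) => [|m ms IHms]; first by rewrite big_nil.
rewrite big_cons /= mpoly.map_mpolyZ mpoly.mevalZ mpoly.map_mpolyX mpoly.mevalX.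
rewrite IHms; congr (_ * _ + _); rewrite -big_enum /=.
by elim: (enum 'I_n) => [|i s /= ->]; rewrite ?big_nil ?big_cons.
Qed.

Lemma mpoly_system_transfer (n : nat) (fs : seq (mpoly.mpoly n k))
    (F1 F2 : rcfType)
    (phi1 : {rmorphism k -> F1}) (phi2 : {rmorphism k -> F2}) :
    {mono phi1 : x y / x <= y} -> {mono phi2 : x y / x <= y} ->
  (exists v : 'I_n -> F1,
     {in fs, forall f, 0 <= mpoly.meval v (mpoly.map_mpoly phi1 f)}) ->
  exists v : 'I_n -> F2,
     {in fs, forall f, 0 <= mpoly.meval v (mpoly.map_mpoly phi2 f)}.
Proof.
move=> mono1 mono2 [v fv].
pose sys := foldr (fun f => And (Le (NatConst k 0) (mpoly_term f))) (Bool true) fs.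
have sysE (F : realFieldType) (phi : {rmorphism k -> F}) (w : seq F) :
    qf_eval w (map_formula phi sys) = all (fun f => 0 <=
      mpoly.meval (fun i : 'I_n => w`_i) (mpoly.map_mpoly phi f)) fs.
  by rewrite /sys; elim: (fs) => //= f s ->; rewrite eval_mpoly_term.
have [|w _] := @qf_transfer n sys F1 F2 phi1 phi2 mono1 mono2.
  exists (mkseq (fun i => if insub i is Some j then v j else 0) n).
    by rewrite size_mkseq.
  rewrite sysE; apply/allP => f /fv; congr (0 <= _); apply: mpoly.meval_eq => i.
  by rewrite nth_mkseq // insubT // => ?; congr (v _); apply: val_inj.
by rewrite sysE => /allP fw; exists (fun i => w`_i).
Qed.

End Elimination.
End QETransfer.

(** * The Krivine-Stengle Positivstellensatz *)

(** Names for the members of the subfield generated by a list; the last three constructors mirror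
    the closure conditions of [is_subfield]. Such finite trees are countable, hence so is the
    subfield. *)
Inductive field_expr : Type :=
| field_var of nat
| field_one
| field_sub of field_expr & field_expr
| field_div of field_expr & field_expr.

Fixpoint encode_field_expr (e : field_expr) : nat :=
  match e with
  | field_var i => choice.pickle (0, i, 0)%N
  | field_one => choice.pickle (1, 0, 0)%N
  | field_sub u v => choice.pickle (2, encode_field_expr u, encode_field_expr v)
  | field_div u v => choice.pickle (3, encode_field_expr u, encode_field_expr v)
  end%N.

Lemma encode_field_expr_inj : injective encode_field_expr.
Proof.
elim=> [i||u IHu v IHv|u IHu v IHv] [j||u' v'|u' v'];
  move=> /(pcan_inj choice.pickleK) // => -[].
- by move=> ->.
- by move=> /IHu -> /IHv ->.
- by move=> /IHu -> /IHv ->.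
Qed.

Fixpoint eval_field_expr (F : fieldType) (s : seq F) (e : field_expr) : F :=
  match e with
  | field_var i => s`_i
  | field_one => 1
  | field_sub u v => eval_field_expr s u - eval_field_expr s v
  | field_div u v => eval_field_expr s u / eval_field_expr s v
  end.

(** Meant for the bare field given by [subfield_pack]: the order of [F] is pulled back so that [v]
    becomes an order embedding. *)
Lemma realfield_pullback (L : fieldType) (F : realFieldType)
    (v : {rmorphism L -> F}) :
  exists (k : realFieldType) (w : {rmorphism k -> F}) (id : k -> L),
    [/\ {mono w : x y / x <= y}, range w = range v & injective id].
Proof.
pose le (x y : L) := v x <= v y.
pose lt (x y : L) := (y != x) && le x y.
pose norm (x : L) := if le 0 x then x else - x.
have le0_add x y : le 0 x -> le 0 y -> le 0 (x + y).
  by rewrite /le rmorph0 rmorphD; exact: addr_ge0.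
have le0_mul x y : le 0 x -> le 0 y -> le 0 (x * y).
  by rewrite /le rmorph0 rmorphM; exact: mulr_ge0.
have le0_anti x : le 0 x -> le x 0 -> x = 0.
  rewrite /le => x0 x0'; apply: (fmorph_inj v); apply/eqP.
  by rewrite eq_le x0 x0'.
have sub_ge0 x y : le 0 (y - x) = le x y.
  by rewrite /le rmorph0 rmorphB Num.Theory.subr_ge0.
have le0_total x : le 0 x || le x 0 by exact: le_total.
have normN x : norm (- x) = norm x.
  rewrite /norm /le rmorph0 rmorphN oppr_ge0; case: ltgtP => // x0.
    by rewrite opprK.
  have -> : x = 0 by apply: (fmorph_inj v); rewrite x0 rmorph0.
  by rewrite oppr0.
have ge0_norm x : le 0 x -> norm x = x by rewrite /norm => ->.
have lt_def x y : lt x y = (y != x) && le x y by [].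
pose k : realFieldType := HB.pack (GRing.Field.sort L)
  (Num.IntegralDomain_isLeReal.Build L le0_add le0_mul le0_anti sub_ge0
     le0_total normN ge0_norm lt_def).
by exists k, (v : {rmorphism L -> F}), id; split=> // x y.
Qed.

Lemma countable_subfield (F : realFieldType) (s : seq F) :
  exists (k : realFieldType) (v : {rmorphism k -> F}) (f : k -> nat),
    [/\ {mono v : x y / x <= y}, {in s, forall x, range v x} & injective f].
Proof.
have K_field : is_subfield (range (eval_field_expr s)).
  split.
  - by exists field_one.
  - by move=> _ _ [u _ <-] [v _ <-]; exists (field_sub u v).
  - by move=> _ _ [u _ <-] [v _ <-]; exists (field_div u v).
have [L [v0 v0K]] := subfield_pack K_field.
have [k [v [j [v_mono vK j_inj]]]] := realfield_pullback v0.
have code a : {e | eval_field_expr s e = v a}.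
  apply: cid; have [e _ <-] : range (eval_field_expr s) (v a).
    by rewrite -v0K -vK; exists a.
  by exists e.
exists k, v, (fun a => encode_field_expr (sval (code a))); split=> //.
  move=> x /(nthP 0)[i lt_is <-]; rewrite vK v0K.
  by exists (field_var i).
move=> a b /encode_field_expr_inj eq_ab; apply: (fmorph_inj v).
by rewrite -(svalP (code a)) eq_ab (svalP (code b)).
Qed.

Lemma mpoly_encoding (n : nat) (k : nzRingType) (f : k -> nat) : injective f ->
  exists g : mpoly.mpoly n k -> nat, injective g.
Proof.
move=> f_inj.
exists (fun p => choice.pickle [seq (m, f (mpoly.mcoeff m p)) | m <- mpoly.msupp p]).
move=> p q /(pcan_inj choice.pickleK) eq_pq.
have supp_pq : mpoly.msupp p = mpoly.msupp q.
  have fstE (g : mpoly.multinom n -> nat) s : map fst [seq (m, g m) | m <- s] = s.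
    by elim: s => //= m s ->.
  by have := congr1 (map fst) eq_pq; rewrite !fstE.
apply/mpoly.mpolyP => m; have [m_p|] := boolP (m \in mpoly.msupp p); last first.
  move=> m_p; have m_q := m_p; rewrite supp_pq in m_q.
  by rewrite !mpoly.memN_msupp_eq0.
move: eq_pq; rewrite -supp_pq => /eq_in_map /(_ m m_p)[]; exact: f_inj.
Qed.

Lemma mpoly_lift (n : nat) (k K : nzRingType) (v : {rmorphism k -> K})
    (p : mpoly.mpoly n K) :
  {in mpoly.msupp p, forall m, range v (mpoly.mcoeff m p)} ->
  exists q, mpoly.map_mpoly v q = p.
Proof.
move=> vp; rewrite [p]mpoly.mpolyE.
have : {subset mpoly.msupp p <= mpoly.msupp p} by [].
elim: {1 3}(mpoly.msupp p) => [|m s IHs] sub_s.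
  by exists 0; rewrite big_nil rmorph0.
have [|q qE] := IHs; first by move=> u us; apply: sub_s; rewrite in_cons us orbT.
have [c _ cE] := vp m (sub_s m (mem_head _ _)).
exists (c *: mpoly.mpolyX k m + q).
by rewrite big_cons rmorphD /= qE mpoly.map_mpolyZ mpoly.map_mpolyX cE.
Qed.

Lemma mpoly_hom_meval (n : nat) (k F : comNzRingType)
    (h : {rmorphism mpoly.mpoly n k -> F}) (w : {rmorphism k -> F}) p :
    (forall c, h (mpoly.mpolyC n c) = w c) ->
  mpoly.meval (fun i => h (mpoly.mpolyX k (mpoly.mnm1 i))) (mpoly.map_mpoly w p)
  = h p.
Proof.
move=> hw; rewrite [in LHS](mpoly.mpolyE p) [in RHS](mpoly.mpolyE p).
rewrite (rmorph_sum (mpoly.map_mpoly w)) !rmorph_sum; apply: eq_bigr => m _ /=.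
rewrite mpoly.map_mpolyZ mpoly.mevalZ mpoly.map_mpolyX mpoly.mevalX.
rewrite -mpoly.mul_mpolyC rmorphM /= hw; congr (_ * _).
by rewrite mpoly.mpolyXE_id rmorph_prod; apply: eq_bigr => i _; rewrite rmorphXn.
Qed.

Theorem krivine_positivstellensatz (R : rcfType) (n : nat)
    (P : set (mpoly.mpoly n R)) (fs : seq (mpoly.mpoly n R)) :
    preordering P -> {in fs, forall f, P f} -> ~ P (-1) ->
  exists y : 'I_n -> R, {in fs, forall f, 0 <= mpoly.meval y f}.
Proof.
move=> P_preo Pfs Pn1.
have [k [v [code [v_mono vs code_inj]]]] := countable_subfield
  (flatten [seq [seq mpoly.mcoeff m f | m <- mpoly.msupp f] | f <- fs]).
have [gs fsE] : exists gs, fs = map (mpoly.map_mpoly v) gs.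
  elim: fs vs {Pfs} => [|f fs IHfs] vs; first by exists [::].
  have [|gs ->] := IHfs; first by move=> x xs; apply: vs; rewrite mem_cat xs orbT.
  have [|g <-] := @mpoly_lift n k R v f; last by exists (g :: gs).
  move=> m mf; apply: vs; rewrite mem_cat; apply/orP; left.
  by apply/mapP; exists m.
pose T := mpoly.map_mpoly v @^-1` P.
have T_preo : preordering T.
  split=> [x y Tx Ty|x y Tx Ty|x]; rewrite /T /= ?(rmorphD, rmorphM, rmorphXn).
  - exact: preorderingD.
  - exact: preorderingM.
  - exact: preordering_sqr.
have Tn1 : ~ T (-1) by rewrite /T /= rmorphN1.
have [enc enc_inj] := @mpoly_encoding n k code code_inj.
have [F [h hT]] := real_closed_point enc_inj T_preo Tn1.
pose w : {rmorphism k -> F} := h \o @mpoly.mpolyC n k.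
(* A nonnegative constant of [k] may lack a square root in [k] but has one in [R], so it lies in [P]
   and hence in [T]. This forces the order of [F] to extend that of [k]. *)
have w_mono : {mono w : x y / x <= y}.
  apply: le_mono => x y lt_xy; rewrite lt_neqAle (inj_eq (fmorph_inj w)).
  rewrite (lt_eqF lt_xy) /= -subr_ge0 -(rmorphB w).
  rewrite -[w _]/(h (mpoly.mpolyC n (y - x))); apply: hT.
  rewrite /T /= mpoly.map_mpolyC.
  have vxy : 0 <= v (y - x) by rewrite -(rmorph0 v) v_mono subr_ge0 ltW.
  have -> : mpoly.mpolyC n (v (y - x)) = mpoly.mpolyC n (Num.sqrt (v (y - x))) ^+ 2.
    by rewrite -rmorphXn /= sqr_sqrtr.
  exact: preordering_sqr.
have [|y hy] := @mpoly_system_transfer k n gs F R w v w_mono v_mono.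
  (* The solution in [F] is the generic point, whose coordinates are the images of the variables. *)
  exists (fun i => h (mpoly.mpolyX k (mpoly.mnm1 i))) => g g_gs.
  rewrite mpoly_hom_meval //; apply: hT; rewrite /T /=; apply: Pfs.
  by rewrite fsE map_f.
by exists y => f; rewrite fsE => /mapP[g g_gs ->]; apply: hy.
Qed.

(** * Archimedean quadratic modules *)

Definition sos (A : comNzRingType) : set A := wsos [set 1] setT.

Lemma sos_preordering (A : comNzRingType) : preordering (@sos A).
Proof.
split=> [x y|x y|x]; first exact: wsosD; last exact: wsos_sqr.
by apply: wsosM => // u v -> ->; rewrite mul1r.
Qed.

(** The preordering generated by [T] and [r] when [T] is one: higher powers of [r] are absorbed
    because [r ^+ 2] lies in [T]. *)
Definition adjoin_weight (A : comNzRingType) (T : set A) (r : A) : set A :=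
  [set x | exists s t, [/\ T s, T t & x = s + t * r]].

Lemma adjoin_weight_preordering (A : comNzRingType) (T : set A) r :
  preordering T -> preordering (adjoin_weight T r).
Proof.
move=> Tp; have TD := preorderingD Tp; have TM := preorderingM Tp.
have Tsqr := preordering_sqr Tp.
split=> [x y|x y|x].
- move=> [s [t [Ts Tt ->]]] [u [v [Tu Tv ->]]].
  by exists (s + u), (t + v); split; [exact: TD|exact: TD|ring].
- move=> [s [t [Ts Tt ->]]] [u [v [Tu Tv ->]]].
  exists (s * u + t * v * r ^+ 2), (s * v + t * u); split; last by ring.
    by apply: (TD); [exact: (TM)|apply: (TM); [exact: (TM)|exact: Tsqr]].
  by apply: TD; exact: TM.
- by exists (x ^+ 2), 0; split; [exact: Tsqr|exact: preordering0|ring].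
Qed.

Lemma sub_adjoin_weight (A : comNzRingType) (T : set A) r :
  preordering T -> T `<=` adjoin_weight T r.
Proof.
by move=> Tp x Tx; exists x, 0; split=> //; [exact: preordering0|ring].
Qed.

Lemma adjoin_weight_mem (A : comNzRingType) (T : set A) r :
  preordering T -> adjoin_weight T r r.
Proof.
by move=> Tp; exists 0, 1; split; [exact: preordering0|exact: preordering1|ring].
Qed.

Definition quadratic_module (A : comNzRingType) (Q : set A) : Prop :=
  [/\ Q 1, forall x y, Q x -> Q y -> Q (x + y) &
      forall u x, Q x -> Q (u ^+ 2 * x)].

Definition archimedean (R : rcfType) (A : comAlgType R) (Q : set A) : Prop :=
  forall a, exists N : R, Q (N%:A - a).

Section QuadraticModules.
Variables (R : realType) (A : comAlgType R).
Implicit Types (Q M : set A) (a b : A).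

Section Closure.
Variable Q : set A.
Hypothesis Qmod : quadratic_module Q.

Lemma quadratic_moduleD x y : Q x -> Q y -> Q (x + y).
Proof. by case: Qmod => _ + _; apply. Qed.

Lemma quadratic_module_sqrM u x : Q x -> Q (u ^+ 2 * x).
Proof. by case: Qmod => _ _; apply. Qed.

Lemma quadratic_module_sqr u : Q (u ^+ 2).
Proof. by rewrite -[u ^+ 2]mulr1; apply: quadratic_module_sqrM; case: Qmod. Qed.

Lemma quadratic_module_sosM s x : sos s -> Q x -> Q (s * x).
Proof.
move=> ss Qx; elim: ss => [|{}s _ u _ Qsx -> _].
  by rewrite mul0r -[0](expr0n A 2); exact: quadratic_module_sqr.
by rewrite mulrDl mul1r; apply: quadratic_moduleD => //; exact: quadratic_module_sqrM.
Qed.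

Lemma quadratic_moduleZ (c : R) x : 0 <= c -> Q x -> Q (c *: x).
Proof.
move=> c0 Qx; have -> : c *: x = ((Num.sqrt c)%:A) ^+ 2 * x.
  by rewrite exprZn expr1n sqr_sqrtr // -scalerAl mul1r.
exact: quadratic_module_sqrM.
Qed.

Lemma quadratic_module_const (c : R) : 0 <= c -> Q c%:A.
Proof. by move=> c0; apply: quadratic_moduleZ => //; case: Qmod. Qed.

Lemma quadratic_module_constN (c : R) : ~ Q (-1) -> Q c%:A -> 0 <= c.
Proof.
move=> Qn1 Qc; rewrite leNgt; apply/negP => c0; apply: Qn1.
have -> : -1 = (- c^-1) *: (c%:A : A).
  by rewrite scalerA mulNr mulVf ?lt_eqF // scaleN1r.
by apply: quadratic_moduleZ => //; rewrite oppr_ge0 invr_le0 ltW.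
Qed.

End Closure.

Lemma maximal_quadratic_module Q : quadratic_module Q -> ~ Q (-1) ->
  exists M, [/\ quadratic_module M, Q `<=` M, ~ M (-1) &
    forall a, M a \/ M (- a)].
Proof.
move=> Qmod Qn1.
pose P M := quadratic_module M /\ ~ M (-1).
have [//|F [X FX] FP Ftot|M [[Mmod Mn1] QM Mmax]] := @zorn_set A P Q.
  split; last by move=> [Y FY]; have [_] := FP Y FY.
  split.
  - by exists X => //; have [[]] := FP X FX.
  - move=> x y [Y FY Yx] [Z FZ Zy]; have [YZ|ZY] := Ftot Y Z FY FZ.
      exists Z => //; have [Zmod _] := FP Z FZ.
      by apply: quadratic_moduleD => //; apply: YZ.
    exists Y => //; have [Ymod _] := FP Y FY.
    by apply: quadratic_moduleD => //; apply: ZY.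
  - move=> u x [Y FY Yx]; exists Y => //; have [Ymod _] := FP Y FY.
    exact: quadratic_module_sqrM.
exists M; split=> // a; apply: contrapT => /not_orP[Ma MNa].
have ext b : ~ M b -> exists x s, [/\ M x, sos s & -1 = x + s * b].
  move=> Mb; pose N := [set y | exists x s, [/\ M x, sos s & y = x + s * b]].
  apply: contrapT => noN; apply: (Mb); rewrite -(Mmax N).
  - exists 0, 1; rewrite add0r mul1r; split=> //.
      by rewrite -[0](expr0n A 2); exact: quadratic_module_sqr.
    exact: preordering1 (sos_preordering A).
  - split=> //; split.
    + exists 1, 0; rewrite mul0r addr0; split=> //; first by case: Mmod.
      exact: preordering0 (sos_preordering A).
    + move=> _ _ [x [s [Mx ss ->]]] [y [t [My st ->]]].
      exists (x + y), (s + t); split; [exact: quadratic_moduleD|exact: wsosD|ring].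
    + move=> u _ [x [s [Mx ss ->]]]; exists (u ^+ 2 * x), (u ^+ 2 * s).
      split; [exact: quadratic_module_sqrM| |ring].
      by apply: preorderingM; [exact: sos_preordering| |]; [exact: wsos_sqr|].
  - move=> x Mx; exists x, 0; rewrite mul0r addr0; split=> //.
    exact: preordering0 (sos_preordering A).
have [x [s [Mx ss xE]]] := ext a Ma; have [y [t [My st yE]]] := ext (- a) MNa.
have sosM u : sos u -> M u.
  by move=> su; rewrite -[u]mulr1; apply: quadratic_module_sosM => //; case: Mmod.
(* Eliminating [a] between [s a = -1 - x] and [t a = 1 + y] puts [- s] in [M], which already
   contains [s]. *)
have MNs : M (- s).
  have -> : - s = t + t * x + s * y.
    have saE : s * a = -1 - x by rewrite xE; ring.
    have taE : t * a = 1 + y by rewrite -[y](addrK (t * - a)) -yE; ring.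
    have : t * (s * a) = s * (t * a) by ring.
    rewrite saE taE => /eqP; rewrite -subr_eq0 => /eqP st0.
    by apply/eqP; rewrite -subr_eq0 -st0; apply/eqP; ring.
  apply: quadratic_moduleD => //; last exact: quadratic_module_sosM.
  apply: quadratic_moduleD => //; [exact: sosM|exact: quadratic_module_sosM].
apply: Mn1; rewrite xE; apply: quadratic_moduleD => //.
(* With [s] and [- s] in [M], writing [4 a] as [(a + 1)^2 - (a - 1)^2] puts [s * a] in [M], and then
   -1. *)
have -> : s * a = (4^-1 : R) *: ((a + 1) ^+ 2 * s + (a - 1) ^+ 2 * - s).
  have -> : (a + 1) ^+ 2 * s + (a - 1) ^+ 2 * - s = (s * a) *+ 4 by ring.
  have -> : s * a *+ 4 = (4 : R) *: (s * a) by rewrite scaler_nat.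
  by rewrite scalerA mulVf ?scale1r.
apply: quadratic_moduleZ => //.
apply: quadratic_moduleD => //; apply: quadratic_module_sqrM => //; exact: sosM.
Qed.

End QuadraticModules.

Section ArchimedeanCharacter.
Variables (R : realType) (A : comAlgType R) (M : set A).
Hypotheses (Mmod : quadratic_module M) (March : archimedean M).
Hypotheses (Mn1 : ~ M (-1)) (Mtotal : forall a, M a \/ M (- a)).

(** The graph of the future character. Working with a relation reduces each algebraic law to
    exhibiting a near value and invoking uniqueness. *)
Let near_value (a : A) (x : R) : Prop := forall e : R, 0 < e ->
  M (e%:A + (a - x%:A)) /\ M (e%:A - (a - x%:A)).

Let MD x y : M x -> M y -> M (x + y).
Proof. exact: quadratic_moduleD. Qed.

Let MC (c : R) : M c%:A -> 0 <= c.
Proof. exact: quadratic_module_constN. Qed.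

Let near_uniq a x y : near_value a x -> near_value a y -> x = y.
Proof.
have le_near u v : near_value a u -> near_value a v -> u <= v.
  move=> au av; apply/ler_addgt0Pr => e e0.
  have e2 : 0 < e / 2 by rewrite divr_gt0.
  have [_ Mu] := av _ e2; have [Mv _] := au _ e2.
  have : M ((v + e - u)%:A).
    have -> : (v + e - u)%:A = ((e / 2)%:A - (a - v%:A)) + ((e / 2)%:A + (a - u%:A)).
      rewrite {1}[e]splitr !(scalerDl, scaleNr); by ring.
    exact: MD.
  by move/MC; rewrite subr_ge0.
by move=> ax ay; apply/eqP; rewrite eq_le !le_near.
Qed.

(** The Archimedean property at [a] bounds [E], and at [- a] makes it nonempty. Totality of [M]
    gives the upper estimate, since otherwise [sup E + e] would belong to [E]. *)
Let near_exists a : exists x, near_value a x.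
Proof.
pose E : set R := [set r | M (a - r%:A)].
have [N MN] := March a; have [N' MN'] := March (- a).
have ubN : ubound E N.
  move=> r Er; rewrite -subr_ge0; apply: MC.
  have -> : (N - r)%:A = (N%:A - a) + (a - r%:A) by rewrite scalerBl; ring.
  exact: MD.
have supE : has_sup E.
  split; last by exists N.
  by exists (- N'); rewrite /E /= scaleNr opprK addrC; rewrite opprK in MN'.
exists (sup E) => e e0; split.
  have [r Er lt_r] := sup_adherent e0 supE.
  have -> : e%:A + (a - (sup E)%:A) = (a - r%:A) + (r - (sup E - e))%:A.
    by rewrite !(scalerBl, scalerDl, scaleNr); ring.
  by apply: MD => //; apply: quadratic_module_const => //; rewrite subr_ge0 ltW.
have [|] := Mtotal (e%:A - (a - (sup E)%:A)) => // MNe.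
have : E (sup E + e).
  rewrite /E /=; have -> : a - (sup E + e)%:A = - (e%:A - (a - (sup E)%:A)) => //.
  by rewrite scalerDl; ring.
by move/(sup_upper_bound supE); rewrite gerDl leNgt e0.
Qed.

Let near_const c : near_value c%:A c.
Proof.
by move=> e e0; rewrite subrr addr0 subr0; split;
  apply: quadratic_module_const => //; exact: ltW.
Qed.

Let near_add a b x y : near_value a x -> near_value b y -> near_value (a + b) (x + y).
Proof.
move=> ax bY e e0; have e2 : 0 < e / 2 by rewrite divr_gt0.
have [M1 M2] := ax _ e2; have [M3 M4] := bY _ e2; rewrite [e]splitr; split.
  have -> : (e / 2 + e / 2)%:A + (a + b - (x + y)%:A)
    = ((e / 2)%:A + (a - x%:A)) + ((e / 2)%:A + (b - y%:A)).
    by rewrite !scalerDl; ring.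
  exact: MD.
have -> : (e / 2 + e / 2)%:A - (a + b - (x + y)%:A)
  = ((e / 2)%:A - (a - x%:A)) + ((e / 2)%:A - (b - y%:A)).
  by rewrite !scalerDl; ring.
exact: MD.
Qed.

Let near_opp a x : near_value a x -> near_value (- a) (- x).
Proof.
move=> ax e e0; have [M1 M2] := ax e e0.
rewrite scaleNr; have -> : - a - - (x%:A : A) = - (a - x%:A) by ring.
by rewrite opprK.
Qed.

Let near_scale c a x : near_value a x -> near_value (c *: a) (c * x).
Proof.
have pos (d : R) b y : 0 < d -> near_value b y -> near_value (d *: b) (d * y).
  move=> d0 bY e e0; have ed : 0 < e / d by rewrite divr_gt0.
  have eE : e%:A = d *: ((e / d)%:A : A).
    by rewrite scalerA mulrC divfK ?gt_eqF.
  have dE : d *: b - (d * y)%:A = d *: (b - y%:A) by rewrite -scalerA scalerBr.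
  have [M1 M2] := bY _ ed; rewrite eE dE -scalerDr -scalerBr.
  by split; apply: quadratic_moduleZ => //; exact: ltW.
move=> ax; have [c0|c0|->] := ltgtP c 0; last first.
- by have := near_const 0; rewrite !scale0r mul0r.
- exact: pos.
- rewrite -[c]opprK scaleNr mulNr; apply/near_opp/pos => //.
  by rewrite oppr_gt0.
Qed.

Let near_sqr0 d : near_value d 0 -> near_value (d ^+ 2) 0.
Proof.
move=> dz e e0; rewrite scale0r subr0; split.
  apply: MD; last exact: quadratic_module_sqr.
  by apply: quadratic_module_const => //; exact: ltW.
have r0 : 0 < Num.sqrt e by rewrite sqrtr_gt0.
have [M1 M2] := dz _ r0; rewrite scale0r subr0 in M1 M2.
set r := (Num.sqrt e)%:A in M1 M2.
have rE : e%:A = r ^+ 2.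
  by rewrite /r exprZn expr1n sqr_sqrtr // ltW.
have -> : e%:A - d ^+ 2 = (2 * Num.sqrt e)^-1 *:
    ((r + d) ^+ 2 * (r - d) + (r - d) ^+ 2 * (r + d)).
  have -> : (r + d) ^+ 2 * (r - d) + (r - d) ^+ 2 * (r + d)
      = (2 * Num.sqrt e) *: (r ^+ 2 - d ^+ 2).
    have -> : (2 * Num.sqrt e) *: (r ^+ 2 - d ^+ 2) = (2 * r) * (r ^+ 2 - d ^+ 2).
      rewrite -scalerA -mulrA /r -scalerAl mul1r mulr_natl scaler_nat.
      by [].
    by ring.
  by rewrite scalerA mulVf ?scale1r -?rE // mulf_neq0 ?pnatr_eq0 // gt_eqF.
apply: quadratic_moduleZ => //.
by apply: MD; apply: quadratic_module_sqrM.
Qed.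

Let near_sqr a x : near_value a x -> near_value (a ^+ 2) (x ^+ 2).
Proof.
move=> ax; have dz : near_value (a - x%:A) 0.
  by rewrite -(subrr x); apply: near_add => //; apply: near_opp; exact: near_const.
have -> : a ^+ 2 = (a - x%:A) ^+ 2 + (((2 * x) *: (a - x%:A)) + (x ^+ 2)%:A).
  have -> : ((x ^+ 2)%:A : A) = (x%:A) ^+ 2 by rewrite exprZn expr1n.
  have -> : (2 * x) *: (a - x%:A) = 2 * (x%:A * (a - x%:A)).
    by rewrite -scalerA -scalerAl mul1r mulr_natl scaler_nat.
  by ring.
have -> : x ^+ 2 = 0 + (2 * x * 0 + x ^+ 2) by ring.
rewrite -[(0 + (2 * x * 0 + x ^+ 2))%:A]/(_ *: _).
apply: near_add; first exact: near_sqr0.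
have -> : 0 + (2 * x * 0 + x ^+ 2) = x ^+ 2 by ring.
by apply: near_add; [exact: near_scale|exact: near_const].
Qed.

Let near_mul a b x y : near_value a x -> near_value b y -> near_value (a * b) (x * y).
Proof.
move=> ax bY.
have -> : a * b = (2^-1 : R) *: ((a + b) ^+ 2 + (- a ^+ 2 + - b ^+ 2)).
  have -> : (a + b) ^+ 2 + (- a ^+ 2 + - b ^+ 2) = (2 : R) *: (a * b).
    by rewrite scaler_nat; ring.
  by rewrite scalerA mulVf ?scale1r // pnatr_eq0.
have -> : x * y = 2^-1 * ((x + y) ^+ 2 + (- x ^+ 2 + - y ^+ 2)) by field.
apply: near_scale; apply: near_add; first exact/near_sqr/near_add.
by apply: near_add; apply/near_opp/near_sqr.
Qed.

Lemma archimedean_character : exists phi : {lrmorphism A -> R^o},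
  forall a, M a -> 0 <= phi a.
Proof.
have [phi0 phi0P] := choice near_exists.
pose phi : A -> R^o := phi0; have phiP : forall a, near_value a (phi a) := phi0P.
have phi_add : zmod_morphism phi.
  move=> a b; apply: near_uniq (phiP _) _; apply: near_add => //.
  exact: near_opp.
have phi_mul : monoid_morphism phi.
  split; last by move=> a b; apply: near_uniq (phiP _) _; apply: near_mul.
  by apply: near_uniq (phiP _) _; rewrite -[X in near_value X _]scale1r.
have phi_scale : scalable phi.
  by move=> c a; apply: near_uniq (phiP _) _; apply: near_scale.
pose h : {lrmorphism A -> R^o} := HB.pack phi (GRing.isZmodMorphism.Build A R^o phi phi_add)
  (GRing.isMonoidMorphism.Build A R^o phi phi_mul)
  (GRing.isScalable.Build R A R^o *:%R phi phi_scale).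
exists h => a Ma /=.
apply/ler_addgt0Pr => e e0; have [_ Me] := phiP a e e0.
rewrite addrC; apply: MC.
have -> : (e + phi a)%:A = (e%:A - (a - (phi a)%:A)) + a.
  by rewrite scalerDl; ring.
exact: MD.
Qed.

End ArchimedeanCharacter.

Theorem jacobi_positivstellensatz (R : realType) (A : comAlgType R) (Q : set A) (f : A) :
    quadratic_module Q -> archimedean Q ->
    (forall phi : {lrmorphism A -> R^o}, (forall q, Q q -> 0 <= phi q) -> 0 < phi f) ->
  Q f.
Proof.
move=> Qmod Qarch f_pos; have QD := quadratic_moduleD Qmod.
(* If there is no such [s], the module [Q - sos f] omits -1, and the character of a maximal
   extension is nonnegative on [Q] and at [- f]. *)
have [s [ss Qsf]] : exists s, sos s /\ Q (s * f - 1).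
  apply: contrapT => nos.
  have sosD := preorderingD (sos_preordering A).
  have sosM := preorderingM (sos_preordering A).
  pose Q1 : set A := [set x | exists q s, [/\ Q q, sos s & x = q - s * f]].
  have Q1mod : quadratic_module Q1.
    split.
    - exists 1, 0; rewrite mul0r subr0; split=> //; first by case: Qmod.
      exact: preordering0 (sos_preordering A).
    - move=> _ _ [p [s [Qp ss ->]]] [q [t [Qq st ->]]].
      by exists (p + q), (s + t); split; [exact: QD|exact: sosD|ring].
    - move=> u _ [p [s [Qp ss ->]]]; exists (u ^+ 2 * p), (u ^+ 2 * s).
      split; [exact: quadratic_module_sqrM| |ring].
      by apply: sosM => //; exact: wsos_sqr.
  have Q1n1 : ~ Q1 (-1).
    move=> [q [s [Qq ss qE]]]; apply: nos; exists s; split=> //.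
    by have -> : s * f - 1 = q by rewrite qE; ring.
  have [M [Mmod Q1M Mn1 Mtotal]] := maximal_quadratic_module Q1mod Q1n1.
  have QM : Q `<=` M.
    move=> q Qq; apply: Q1M; exists q, 0; rewrite mul0r subr0; split=> //.
    exact: preordering0 (sos_preordering A).
  have March : archimedean M by move=> a; have [N QN] := Qarch a; exists N; exact: QM.
  have [phi phiM] := archimedean_character Mmod March Mn1 Mtotal.
  have : M (- f).
    apply: Q1M; exists 0, 1; rewrite mul1r sub0r; split=> //.
      by rewrite -[0](expr0n A 2); exact: quadratic_module_sqr.
    exact: preordering1 (sos_preordering A).
  move/phiM; rewrite raddfN oppr_ge0 leNgt f_pos // => q Qq.
  exact/phiM/QM.
have [N1 QN1] := Qarch s; have [N2 QN2] := Qarch (s ^+ 2 * f).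
have [r0 Qr0] := Qarch (- f); rewrite opprK in Qr0.
(* A common bound for [s] and [s^2 f] relative to [Q]; the summand 1 keeps it positive. *)
pose k : R := `|N1| + `|N2| + 1.
have k_gt0 : 0 < k by rewrite ltr_wpDl // addr_ge0.
have Qup (N : R) a : N <= k -> Q (N%:A - a) -> Q (k%:A - a).
  move=> Nk QN; have -> : k%:A - a = (N%:A - a) + (k - N)%:A.
    by rewrite scalerBl; ring.
  by apply: QD => //; apply: quadratic_module_const => //; rewrite subr_ge0.
have Qks : Q (k%:A - s).
  apply: Qup QN1; rewrite /k -addrA (le_trans (ler_norm _)) // lerDl.
  by rewrite addr_ge0.
have Qksf : Q (k%:A - s ^+ 2 * f).
  apply: Qup QN2; rewrite /k addrAC (le_trans (ler_norm _)) // lerDr.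
  by rewrite addr_ge0.
(* This rests on [k^2 (f + r) - k = (k - s)^2 (f + r) + 2 k (s f - 1) + r s (2 k - s) + (k - s^2
   f)], where every summand on the right is in [Q]. *)
have descent (r : R) : 0 <= r -> Q (f + r%:A) -> Q (f + (r - k^-1)%:A).
  move=> r_ge0 Qfr.
  have -> : f + (r - k^-1)%:A = (k ^- 2) *: ((k%:A - s) ^+ 2 * (f + r%:A)
      + (2 * k) *: (s * f - 1) + r *: (s * (k%:A + (k%:A - s)))
      + (k%:A - s ^+ 2 * f)).
    have k2 : k ^+ 2 != 0 by rewrite expf_neq0 ?gt_eqF.
    have -> : (2 * k) *: (s * f - 1) = 2 * k%:A * (s * f - 1).
      by rewrite -scalerA -mulrA -scalerAl mul1r mulr_natl scaler_nat.
    have -> : r *: (s * (k%:A + (k%:A - s))) = r%:A * (s * (k%:A + (k%:A - s))).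
      by rewrite mulr_algl.
    set X := (X in _ = _ *: X).
    have -> : X = (k%:A) ^+ 2 * (f + r%:A) - k%:A by rewrite /X; ring.
    have -> : (k%:A) ^+ 2 * (f + r%:A) = k ^+ 2 *: (f + r%:A).
      by rewrite exprZn expr1n mulr_algl.
    have -> : (k%:A : A) = k ^+ 2 *: (k^-1)%:A.
      by rewrite scalerA expr2 mulfK ?gt_eqF.
    by rewrite -scalerBr scalerA mulVf // scale1r scalerBl addrA.
  apply: quadratic_moduleZ => //; first by rewrite invr_ge0 exprn_ge0 // ltW.
  apply: (QD) => //; apply: (QD); last first.
    apply: quadratic_moduleZ => //; apply: quadratic_module_sosM => //.
    by apply: (QD) => //; apply: quadratic_module_const => //; exact: ltW.
  apply: (QD); first exact: quadratic_module_sqrM.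
  by apply: quadratic_moduleZ => //; rewrite mulr_ge0 // ltW.
apply: contrapT => Qf.
have r_ge0 (r : R) : Q (f + r%:A) -> 0 <= r.
  move=> Qfr; rewrite leNgt; apply/negP => r_lt0; apply: Qf.
  have -> : f = f + r%:A + (- r)%:A by rewrite scaleNr; ring.
  by apply: QD => //; apply: quadratic_module_const => //; rewrite oppr_ge0 ltW.
(* The decrement [1 / k] does not depend on [r], so iterating the descent makes the constant
   negative. *)
have all_j (j : nat) : Q (f + (r0 - j%:R / k)%:A).
  elim: j => [|j IHj]; first by rewrite mul0r subr0 addrC.
  have -> : r0 - j.+1%:R / k = r0 - j%:R / k - k^-1 by rewrite -natr1; ring.
  by apply: descent => //; exact: r_ge0.
have := r_ge0 _ (all_j (Num.bound `|r0 * k|)).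
rewrite subr_ge0 ler_pdivrMr //; apply/negP; rewrite -ltNge.
by apply: le_lt_trans (ler_norm _) (archi_boundP (normr_ge0 _)).
Qed.

Lemma preordering_quadratic_module (A : comNzRingType) (T : set A) :
  preordering T -> quadratic_module T.
Proof.
move=> Tp; split; [exact: preordering1|exact: preorderingD|move=> u x Tx].
by apply: preorderingM => //; exact: preordering_sqr.
Qed.

(* Woermann's trick: [(1 + t0) (rho - b)] lies in [T], and so do
   [rho + rho t0 - b] and then [s + s ^ 2 / 4 - t0]. *)
Lemma woermann (R : realType) (A : comAlgType R) (T : set A) (rho s : R)
    (b t0 t1 : A) :
    preordering T -> T t0 -> T t1 -> T b -> 0 <= rho ->
    t1 * (rho%:A - b) = 1 + t0 ->
    adjoin_weight T (rho%:A - b) (s%:A - t0) ->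
  exists N : R, T (N%:A - b).
Proof.
move=> Tp Tt0 Tt1 Tb rho0 t1E [u [v [Tu Tv sE]]].
have Tmod := preordering_quadratic_module Tp.
have TD := preorderingD Tp; have TM := preorderingM Tp.
have Tsqr := preordering_sqr Tp.
have T1r : T ((1 + t0) * (rho%:A - b)).
  by rewrite -t1E -mulrA -expr2; apply: TM.
have T1t0 : T (1 + t0) by apply: TD => //; exact: preordering1.
(* The factor [1 + t0] turns [v (rho - b)] into [v t1 (rho - b)^2], so the bound on [t0] comes down
   from the enlarged preordering to [T]. *)
have Tst : T ((s%:A - t0) * (1 + t0)).
  rewrite sE mulrDl -mulrA [_ * (1 + t0)]mulrC.
  by rewrite [X in _ + v * X]mulrC; apply: (TD); apply: (TM).
pose N := rho * (s + (s / 2) ^+ 2) + rho.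
exists N; have -> : N%:A - b = rho *: ((s%:A - t0) * (1 + t0)
    + ((s / 2)%:A - t0) ^+ 2) + ((1 + t0) * (rho%:A - b) + t0 * b).
  have -> : (s%:A - t0) * (1 + t0) + ((s / 2)%:A - t0) ^+ 2
      = (s + (s / 2) ^+ 2)%:A - t0.
    pose u2 : A := (s / 2)%:A.
    have s_E : s%:A = u2 + u2 by rewrite -scalerDl -splitr.
    have sqE : ((s / 2) ^+ 2)%:A = u2 ^+ 2 by rewrite [RHS]exprZn expr1n.
    by rewrite scalerDl sqE s_E -/u2; ring.
  rewrite scalerBr scalerA /N scalerDl -[rho *: t0]mulr_algl.
  by ring.
apply: (TD); last by apply: (TD) => //; apply: (TM).
by apply: quadratic_moduleZ => //; apply: (TD) => //.
Qed.

(** * Putinar's Positivstellensatz *)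

Section BoundedElements.
Variables (R : realType) (A : comAlgType R) (T : set A).
Hypothesis Tp : preordering T.

(** These elements form a subalgebra, so [T] is Archimedean as soon as it bounds the variables. *)
Definition bounded_element (a : A) : Prop :=
  exists N : R, T (N%:A - a) /\ T (N%:A + a).

Let Tmod := preordering_quadratic_module Tp.
Let TD := preorderingD Tp.
Let TM := preorderingM Tp.

Lemma bounded_element_add a b :
  bounded_element a -> bounded_element b -> bounded_element (a + b).
Proof.
move=> [N [TN1 TN2]] [K [TK1 TK2]]; exists (N + K); rewrite scalerDl; split.
  have -> : N%:A + K%:A - (a + b) = (N%:A - a) + (K%:A - b) by ring.
  exact: TD.
have -> : N%:A + K%:A + (a + b) = (N%:A + a) + (K%:A + b) by ring.
exact: TD.
Qed.

Lemma bounded_element_mul a b :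
  bounded_element a -> bounded_element b -> bounded_element (a * b).
Proof.
move=> [N [TN1 TN2]] [K [TK1 TK2]]; exists (N * K).
have half (x : A) : T (2 * x) -> T x.
  move=> T2x; have -> : x = (2^-1 : R) *: (2 * x).
    have -> : 2 * x = (2 : R) *: x by rewrite scaler_nat mulr_natl.
    by rewrite scalerA mulVf ?scale1r // pnatr_eq0.
  exact: quadratic_moduleZ.
have NK : (N * K)%:A = N%:A * K%:A :> A by rewrite mulr_algl scalerA.
split; apply: half; rewrite NK.
  have -> : 2 * (N%:A * K%:A - a * b)
    = (N%:A - a) * (K%:A + b) + (N%:A + a) * (K%:A - b) by ring.
  by apply: TD; apply: TM.
have -> : 2 * (N%:A * K%:A + a * b)
  = (N%:A - a) * (K%:A - b) + (N%:A + a) * (K%:A + b) by ring.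
by apply: TD; apply: TM.
Qed.

Lemma bounded_element_const (c : R) : bounded_element c%:A.
Proof.
exists `|c|; rewrite -scalerBl -scalerDl; split; apply: quadratic_module_const => //.
  by rewrite subr_ge0 ler_norm.
by rewrite -[c in _ + c]opprK subr_ge0 -normrN ler_norm.
Qed.

End BoundedElements.

Lemma ball_archimedean (R : realType) (n : nat) (T : set (mpoly.mpoly n R)) (rho : R) :
    preordering T ->
    T (rho%:A - \sum_(i < n) (mpoly.mpolyX R (mpoly.mnm1 i)) ^+ 2) ->
  archimedean T.
Proof.
move=> Tp Tr; have TD := preorderingD Tp; have Tsqr := preordering_sqr Tp.
have bX i : bounded_element T (mpoly.mpolyX R (mpoly.mnm1 i)).
  (* The added 1/4 completes the square: [rho + 1/4 - x] is [rho - (x^2 + s)] plus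
     [s + (x - 1/2)^2], where [s] collects the other squares. *)
  exists (rho + (2^-1) ^+ 2); move: Tr; rewrite (bigD1 i) //= scalerDl.
  set x : mpoly.mpoly n R := mpoly.mpolyX R _; set s := \sum_(j < n | _) _ => Tr.
  have Ts : T s.
    by apply: (big_ind T) => [||j _]; [exact: preordering0|exact: TD|exact: Tsqr].
  pose h : mpoly.mpoly n R := (2^-1)%:A.
  have h2 : ((2^-1) ^+ 2)%:A = h ^+ 2 by rewrite [RHS]exprZn expr1n.
  have hh : h + h = 1.
    have half : 2^-1 + 2^-1 = 1 :> R by field.
    by rewrite -scalerDl half scale1r.
  rewrite h2; split.
    have -> : rho%:A + h ^+ 2 - x = (rho%:A - (x ^+ 2 + s)) + s + (x - h) ^+ 2.
      by rewrite -[x in LHS]mulr1 -hh; ring.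
    by apply: (TD) => //; apply: (TD).
  have -> : rho%:A + h ^+ 2 + x = (rho%:A - (x ^+ 2 + s)) + s + (x + h) ^+ 2.
    by rewrite -[x in LHS]mulr1 -hh; ring.
  by apply: (TD) => //; apply: (TD).
have b1 : bounded_element T 1.
  by rewrite -[1](scale1r (1 : mpoly.mpoly n R)); exact: bounded_element_const.
suff ball p : bounded_element T p by move=> p; have [N [TN _]] := ball p; exists N.
rewrite [p]mpoly.mpolyE; apply: (big_ind (bounded_element T)).
- by rewrite -(scale0r (1 : mpoly.mpoly n R)); exact: bounded_element_const.
- by move=> a b; exact: bounded_element_add.
- move=> m _; rewrite -[_ *: _]mulr_algl; apply: bounded_element_mul => //.
    exact: bounded_element_const.
  rewrite mpoly.mpolyXE_id; apply: (big_ind (bounded_element T)) => //.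
    by move=> a b; exact: bounded_element_mul.
  move=> i _; elim: (mpoly.fun_of_multinom m i) => [|k IHk]; rewrite ?expr0 //.
  by rewrite exprS; apply: bounded_element_mul.
Qed.

Section Putinar.
Variables (R : realType) (n s : nat) (g : 'I_s -> mpoly.mpoly n R).

Lemma is_sosP (p : mpoly.mpoly n R) : is_sos p <-> sos p.
Proof.
split=> [[qs ->]|]; first exact: wsos_sum.
elim=> [|{}p _ u _ [qs ->] -> _]; first by exists [::]; rewrite big_nil.
by exists (u :: qs); rewrite big_cons mul1r addrC.
Qed.

Lemma quad_module_quadratic : quadratic_module (quad_module g).
Proof.
have sosp := @sos_preordering (mpoly.mpoly n R).
have sosD := preorderingD sosp; have sosM := preorderingM sosp.
split.
- exists 1, (fun _ => 0); split=> [|j|]; last by rewrite big1 ?addr0 // => j _; rewrite mul0r.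
    by apply/is_sosP; exact: preordering1.
  by apply/is_sosP; exact: preordering0.
- move=> _ _ [s0 [sg [/is_sosP ss0 ssg ->]]] [t0 [tg [/is_sosP st0 stg ->]]].
  exists (s0 + t0), (fun j => sg j + tg j); split=> [|j|].
  + exact/is_sosP/sosD.
  + by apply/is_sosP/sosD; apply/is_sosP.
  + by rewrite addrACA -big_split; congr (_ + _); apply: eq_bigr => j _; rewrite mulrDl.
- move=> u _ [s0 [sg [/is_sosP ss0 ssg ->]]].
  exists (u ^+ 2 * s0), (fun j => u ^+ 2 * sg j); split=> [|j|].
  + by apply/is_sosP/sosM => //; exact: wsos_sqr.
  + by apply/is_sosP/sosM; [exact: wsos_sqr|exact/is_sosP].
  + by rewrite mulrDr mulr_sumr; congr (_ + _); apply: eq_bigr => j _; rewrite mulrA.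
Qed.

Lemma quad_module_gen j : quad_module g (g j).
Proof.
exists 0, (fun i => (i == j)%:R); split=> [|i|].
- by apply/is_sosP; exact: preordering0 (sos_preordering _).
- apply/is_sosP; case: (i == j); first exact: preordering1 (sos_preordering _).
  exact: preordering0 (sos_preordering _).
- rewrite add0r (bigD1 j) //= eqxx mul1r big1 ?addr0 // => i /negPf ->.
  by rewrite mul0r.
Qed.

Lemma quad_module_ge0 p y : quad_module g p -> semialg_set g y -> 0 <= peval p y.
Proof.
have sos_ge0 q : is_sos q -> 0 <= peval q y.
  move=> [qs ->]; rewrite /peval rmorph_sum; apply: sumr_ge0 => r _.
  by rewrite rmorphXn sqr_ge0.
move=> [s0 [sg [ss0 ssg ->]]] gy; rewrite /peval rmorphD rmorph_sum.
apply: addr_ge0; first exact: sos_ge0.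
apply: sumr_ge0 => j _; rewrite rmorphM; apply: mulr_ge0; last exact: gy.
exact: sos_ge0.
Qed.

Lemma lrmorphism_peval (phi : {lrmorphism mpoly.mpoly n R -> R^o}) p :
  phi p = peval p (\row_i phi (mpoly.mpolyX R (mpoly.mnm1 i))).
Proof.
rewrite /peval [p]mpoly.mpolyE !rmorph_sum; apply: eq_bigr => m _ /=.
rewrite linearZ mpoly.mevalZ; congr (_ * _).
rewrite mpoly.mpolyXE_id !rmorph_prod; apply: eq_bigr => i _.
by rewrite !rmorphXn /= mpoly.mevalXU mxE.
Qed.

(** The norm of a row is its largest absolute value, so a bound [B] on it bounds the sum of squares
    by [n B^2]. The extra 1 makes the inequality strict, so that [psi >= 0] and [|y|^2 >= rho]
    exclude each other. *)
Lemma compact_ball (K : set 'rV[R]_n) : compact K ->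
  exists2 rho : R, 0 <= rho & forall y, K y -> \sum_(i < n) y ord0 i ^+ 2 < rho.
Proof.
move=> /compact_bounded[N [_ KN]].
pose B := `|N| + 1.
have BN : N < B by rewrite /B ltr_pwDr // ler_norm.
exists (n%:R * B ^+ 2 + 1); first by rewrite addr_ge0 // mulr_ge0 // sqr_ge0.
move=> y Ky; have yB := KN B BN y Ky.
apply: le_lt_trans (_ : n%:R * B ^+ 2 < _); last by rewrite ltrDl.
have -> : n%:R * B ^+ 2 = \sum_(i < n) B ^+ 2.
  by rewrite sumr_const card_ord mulr_natl.
apply: ler_sum => i _; rewrite -real_normK ?num_real //.
rewrite lerXn2r ?nnegrE //; first by rewrite addr_ge0.
apply: le_trans yB; rewrite [leRHS]/Num.Def.normr /= mx_normrE.
by apply/bigmax_geP; right => /=; exists (ord0, i).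
Qed.

Lemma quad_module_archimedean : archimedean_module g -> archimedean (quad_module g).
Proof.
move=> [psi [Qpsi /compact_ball[rho rho_ge0 psi_ball]]].
pose b : mpoly.mpoly n R := \sum_(i < n) (mpoly.mpolyX R (mpoly.mnm1 i)) ^+ 2.
have Qmod := quad_module_quadratic.
have sosp := @sos_preordering (mpoly.mpoly n R).
pose T := adjoin_weight (@sos (mpoly.mpoly n R)) psi.
have Tp : preordering T by exact: adjoin_weight_preordering.
have sosQ q : sos q -> quad_module g q.
  move=> sq; rewrite -[q]mulr1; apply: quadratic_module_sosM => //.
  by case: Qmod.
have TQ : T `<=` quad_module g.
  move=> _ [u [v [su sv ->]]]; apply: (quadratic_moduleD Qmod); first exact: sosQ.
  exact: quadratic_module_sosM.
have Tb : T b.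
  apply: (big_ind T); [exact: preordering0|exact: preorderingD|move=> i _].
  exact: preordering_sqr.
(* The certificate [-1 = t0 + t1 (b - rho)] of the emptiness of the set where [psi >= 0] and
   [b >= rho]. *)
have [t0 [t1 [Tt0 Tt1 t1E]]] : exists t0 t1, [/\ T t0, T t1 & t1 * (rho%:A - b) = 1 + t0].
  have Pp := @adjoin_weight_preordering _ T (b - rho%:A) Tp.
  suff [u [v [Tu Tv uvE]]] : adjoin_weight T (b - rho%:A) (-1).
    exists u, v; split=> //; apply/eqP; rewrite -subr_eq0.
    have -> : v * (rho%:A - b) - (1 + u) = -1 - (u + v * (b - rho%:A)) by ring.
    by rewrite -uvE subrr.
  apply: contrapT => Pn1.
  have [|y yge0] := krivine_positivstellensatz (fs := [:: psi; b - rho%:A]) Pp _ Pn1.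
    move=> f; rewrite !inE => /orP[]/eqP ->.
      by apply: sub_adjoin_weight => //; exact: adjoin_weight_mem.
    exact: adjoin_weight_mem.
  have psi_y : 0 <= peval psi (\row_i y i).
    rewrite /peval (mpoly.meval_eq (v2 := y)) => [|i]; last by rewrite mxE.
    by apply: yge0; rewrite mem_head.
  have := psi_ball _ psi_y; rewrite ltNge => /negP; apply.
  have := yge0 (b - rho%:A); rewrite !inE eqxx orbT => /(_ isT).
  rewrite mpoly.mevalB mpoly.mevalZ mpoly.meval1 mulr1 subr_ge0 /b rmorph_sum.
  congr (_ <= _); apply: eq_bigr => i _.
  by rewrite rmorphXn /= mpoly.mevalXU mxE.
(* Adjoining [rho - b] makes the preordering Archimedean by fiat, which bounds [t0]. Woermann's
   trick then removes this weight and leaves [K - b] in [T] itself. *)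
have Trp := @adjoin_weight_preordering _ T (rho%:A - b) Tp.
have [N TN] := ball_archimedean Trp (adjoin_weight_mem _ Tp) t0.
have [K TK] := woermann Tp Tt0 Tt1 Tb rho_ge0 t1E TN.
move=> p; have [L TL] := ball_archimedean Tp TK p.
by exists L; exact: TQ.
Qed.

(** A character of the polynomial algebra is evaluation at a point; being nonnegative on the module,
    in particular at each [g j], places that point in S. *)
Theorem putinar_positivstellensatz (f : mpoly.mpoly n R) :
    archimedean_module g -> (forall y, semialg_set g y -> 0 < peval f y) ->
  quad_module g f.
Proof.
move=> /quad_module_archimedean Qarch f_pos.
apply: jacobi_positivstellensatz => //; first exact: quad_module_quadratic.
move=> phi phi_ge0; rewrite lrmorphism_peval; apply: f_pos => j.
by rewrite -lrmorphism_peval; apply: phi_ge0; exact: quad_module_gen.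
Qed.

End Putinar.

(** * Semi-infinite programs *)

Section SemiInfiniteProgram.
Variables (R : realType) (n m s : nat) (c : 'cV[R]_m).
Variables (a : 'I_m -> mpoly.mpoly n R) (b : mpoly.mpoly n R).
Variable g : 'I_s -> mpoly.mpoly n R.

Lemma peval_constraint_poly (x : 'cV[R]_m) (y : 'rV[R]_n) :
  peval (constraint_poly a b x) y = constraint_value a b x y.
Proof.
rewrite /peval /constraint_poly rmorphD rmorph_sum; congr (_ + _).
by apply: eq_bigr => i _ /=; rewrite mpoly.mevalZ mulrC.
Qed.

Lemma quad_module_truncW k p : quad_module_trunc g k p -> quad_module g p.
Proof. by move=> [s0 [sg [[ss0 ssg] _ _ ->]]]; exists s0, sg. Qed.

Lemma quad_module_trunc_le k l p : (k <= l)%N ->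
  quad_module_trunc g k p -> quad_module_trunc g l p.
Proof.
move=> le_kl [s0 [sg [ss d0 dg ->]]]; have le2 : (2 * k <= 2 * l)%N by rewrite leq_mul2l.
by exists s0, sg; split=> // [|j]; [apply: leq_trans le2|apply: leq_trans (dg j) le2].
Qed.

Lemma quad_module_trunc_ex p : quad_module g p -> exists k, quad_module_trunc g k p.
Proof.
move=> [s0 [sg [ss0 ssg ->]]].
(* The largest degree itself serves as [k], so the bound [2 * k] holds with room to spare. *)
exists (maxn (pdeg s0) (\max_(j < s) pdeg (sg j * g j)%R)), s0, sg.
split=> // [|j]; rewrite mul2n -addnn; apply: leq_trans (leq_addr _ _).
  exact: leq_maxl.
by apply: leq_trans (leq_maxr _ _); exact: (leq_bigmax j).
Qed.

Lemma p_sos_nonincreasing k l : (k <= l)%N -> (p_sos c a b g l <= p_sos c a b g k)%E.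
Proof.
move=> le_kl; apply: ereal_inf_le_tmp => _ [x Qx <-]; exists x => //.
exact: quad_module_trunc_le Qx.
Qed.

Lemma p_star_le_p_sos k : (p_star c a b g <= p_sos c a b g k)%E.
Proof.
apply: ereal_inf_le_tmp => _ [x Qx <-]; exists x => //= y gy.
by rewrite -peval_constraint_poly; apply: quad_module_ge0 gy; exact: quad_module_truncW Qx.
Qed.

Lemma objective_segment (t : R) (x z : 'cV[R]_m) :
  objective c (x + t *: (z - x)) = objective c x + t * (objective c z - objective c x).
Proof.
rewrite /objective -sumrB mulr_sumr -big_split; apply: eq_bigr => i _ /=.
by rewrite !mxE; ring.
Qed.

Lemma constraint_value_segment (t : R) (x z : 'cV[R]_m) y :
  constraint_value a b (x + t *: (z - x)) y
  = (1 - t) * constraint_value a b x y + t * constraint_value a b z y.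
Proof.
rewrite /constraint_value; set B := peval b y.
have -> : \sum_(i < m) peval (a i) y * (x + t *: (z - x)) i ord0
    = (1 - t) * (\sum_(i < m) peval (a i) y * x i ord0)
      + t * (\sum_(i < m) peval (a i) y * z i ord0).
  rewrite !mulr_sumr -big_split; apply: eq_bigr => i _ /=.
  by rewrite !mxE; ring.
by ring.
Qed.

Lemma strictly_feasible_near (x : 'cV[R]_m) (e : R) : slater a b g -> 0 < e ->
    (forall y, semialg_set g y -> 0 <= constraint_value a b x y) ->
  exists2 z : 'cV[R]_m, objective c z <= objective c x + e &
    forall y, semialg_set g y -> 0 < constraint_value a b z y.
Proof.
move=> [w w_slater] e0 x_feas.
pose d := objective c w - objective c x.
(* Chosen so that [0 < t <= 1] and [t * |d| <= e]; the summand [e] keeps the denominator positive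
   when [d = 0]. *)
pose t := e / (`|d| + e).
have den0 : 0 < `|d| + e by rewrite ltr_wpDl.
have t0 : 0 < t by rewrite divr_gt0.
have t1 : t <= 1 by rewrite ler_pdivrMr // mul1r lerDr.
exists (x + t *: (w - x)) => [|y gy].
  rewrite objective_segment lerD2l -/d; apply: le_trans (_ : t * `|d| <= _).
    by rewrite ler_wpM2l ?ler_norm // ltW.
  by rewrite /t mulrAC ler_pdivrMr // ler_pM2l // lerDl ltW.
rewrite constraint_value_segment ltr_wpDl //.
  by rewrite mulr_ge0 ?subr_ge0 // x_feas.
by rewrite mulr_gt0 // w_slater.
Qed.

Lemma inf_p_sos : archimedean_module g -> slater a b g ->
  ereal_inf (range (p_sos c a b g)) = p_star c a b g.
Proof.
move=> Qarch slater_P; apply/eqP; rewrite eq_le; apply/andP; split; last first.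
  by apply: le_ereal_inf_tmp => _ [k _ <-]; exact: p_star_le_p_sos.
apply: le_ereal_inf_tmp => _ [x x_feas <-]; apply/lee_addgt0Pr => e e0.
have [z z_obj z_feas] := strictly_feasible_near slater_P e0 x_feas.
(* The Positivstellensatz gives a certificate without degree bound, so the order [k] depends on [z]
   and hence on [e]. *)
have [|k Qz] := @quad_module_trunc_ex (constraint_poly a b z).
  apply: putinar_positivstellensatz => // y gy.
  by rewrite peval_constraint_poly; exact: z_feas.
apply: (@le_trans _ _ (p_sos c a b g k)).
  by apply: ereal_inf_lbound; exists k.
apply: (@le_trans _ _ (objective c z)%:E); last by rewrite -EFinD lee_fin.
by apply: ereal_inf_lbound; exists z.
Qed.

End SemiInfiniteProgram.

Theorem theorem3p3 (R : realType) (n m s : nat) (c : 'cV[R]_m)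
  (a : 'I_m -> mpoly.mpoly n R) (b : mpoly.mpoly n R)
  (g : 'I_s -> mpoly.mpoly n R)
  (p_star_bounded : (-oo < p_star c a b g)%E)
  (p_star_feasible : (p_star c a b g < +oo)%E)
  (S_compact : compact (semialg_set g))
  (Q_archimedean : archimedean_module g)
  (slater_P : slater a b g) :
  (forall k l : nat, (d_P a b g <= k)%N -> (k <= l)%N ->
     (p_sos c a b g l <= p_sos c a b g k)%E) /\
  (p_sos c a b g k @[k --> \oo] --> p_star c a b g).
Proof.
split; first by move=> k l _; exact: p_sos_nonincreasing.
rewrite -(inf_p_sos c Q_archimedean slater_P).
(* In the extended reals a nonincreasing sequence tends to its infimum, even if its first values are
   [+oo]. *)
by apply: ereal_nonincreasing_cvgn => k l; exact: p_sos_nonincreasing.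
Qed.
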